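(* Let $R$ be a complete discrete valuation ring with uniformizer $\pi$ and let $G$ be a flat affine group scheme over $R$ (not necessarily of finite type). If $G$ is prudent, then $\mathfrak d(R[G])=\bigcap_{n\ge0}\pi^nR[G]=0$.
   Context: For $V$ an $R$-module with a $G$-comodule structure $\rho:V\to V\otimes_RR[G]$, an element $\mathbf v\in V$ is a semi-invariant if $R\mathbf v$ is a subrepresentation, equivalently $\rho(\mathbf v)=\mathbf v\otimes\theta$ for some $\theta\in R[G]$. $\mathrm{Rep}^\circ_R(G)$ denotes the category of representations of $G$ whose underlying $R$-module is free of finite rank. $V\in\mathrm{Rep}^\circ_R(G)$ is prudent if every $\mathbf v\in V$ whose image in $V/\pi^{n+1}V$ is a semi-invariant (of the $G$-representation $V/\pi^{n+1}V$) for every $n\ge0$ is itself a semi-invariant of $V$. $G$ is prudent if every object of $\mathrm{Rep}^\circ_R(G)$ is prudent. For an $R$-module $M$, $\mathfrak d(M)=\bigcap_n\pi^nM$ is its divisible submodule. *)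

(* Defs.v *)
From HB Require Import structures.
From mathcomp Require Import all_boot all_order all_algebra.
Set Implicit Arguments. Unset Strict Implicit. Unset Printing Implicit Defensive.
Import GRing.Theory.
Local Open Scope ring_scope.

Definition is_dvr_uniformizer (R : idomainType) (pi : R) : Prop :=
  [/\ pi != 0, pi \isn't a GRing.unit &
      forall x : R, x != 0 -> exists (k : nat) (u : R), u \is a GRing.unit /\ x = u * pi ^+ k].

Definition pi_adically_complete (R : idomainType) (pi : R) : Prop :=
  forall x : nat -> R,
    (forall n, exists y, x n.+1 - x n = pi ^+ n * y) ->
    exists l : R, forall n, exists y, l - x n = pi ^+ n * y.

(* Flatness of an R-module, via the equational criterion of flatness. *)
Definition flat_module (R : comNzRingType) (M : lmodType R) : Prop :=
  forall (n : nat) (r : 'I_n -> R) (x : 'I_n -> M),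
    \sum_(i < n) r i *: x i = 0 ->
    exists (m : nat) (a : 'I_n -> 'I_m -> R) (y : 'I_m -> M),
      (forall i, x i = \sum_(j < m) a i j *: y j) /\
      (forall j, \sum_(i < n) r i * a i j = 0).

Notation pts A B := {lrmorphism A -> B}.

(* An affine group scheme G = Spec A over R, given (following Waterhouse) as a
   group structure on the functor B |-> Hom_{R-alg}(A, B) on commutative
   R-algebras, natural in B.  A is the coordinate ring R[G]. *)
Record affine_group_scheme (R : comNzRingType) (A : comAlgType R) := AGS {
  gmul : forall B : comAlgType R, pts A B -> pts A B -> pts A B;
  gone : forall B : comAlgType R, pts A B;
  gmul_natural : forall (B C : comAlgType R) (phi : {lrmorphism B -> C})
      (g h : pts A B),
      (phi \o gmul g h) =1 gmul (phi \o g : pts A C) (phi \o h : pts A C);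
  gone_natural : forall (B C : comAlgType R) (phi : {lrmorphism B -> C}),
      (phi \o gone B) =1 gone C;
  gmulA : forall (B : comAlgType R) (g h k : pts A B),
      gmul g (gmul h k) =1 gmul (gmul g h) k;
  gmul1g : forall (B : comAlgType R) (g : pts A B), gmul (gone B) g =1 g;
  gmulg1 : forall (B : comAlgType R) (g : pts A B), gmul g (gone B) =1 g;
  gmulV : forall (B : comAlgType R) (g : pts A B),
      exists h : pts A B, gmul g h =1 gone B /\ gmul h g =1 gone B
}.

(* An object of Rep°_R(G) with underlying module R^n: a comodule structure
   rho : R^n -> R^n (x) R[G] = R[G]^n, rho(e_j) = \sum_i e_i (x) M i j,
   encoded by its coefficient matrix M; the comodule axioms are exactly that
   g |-> (g (M i j))_{i,j} is a (natural) group homomorphism G -> GL_n. *)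
Definition is_rep (R : comNzRingType) (A : comAlgType R)
    (G : affine_group_scheme A) (n : nat) (M : 'M[A]_n) : Prop :=
  (forall (B : comAlgType R) (g h : pts A B),
      map_mx (gmul G g h) M = map_mx g M *m map_mx h M) /\
  (forall B : comAlgType R, map_mx (gone G B) M = 1%:M).

(* rho(v) = \sum_i e_i (x) (\sum_j v_j M i j); v (x) theta = \sum_i e_i (x) v_i theta.
   The image of v in V/pi^m V is a semi-invariant of V/pi^m V iff
   rho(v) - v (x) theta lies in pi^m (V (x) R[G]) for some theta. *)
Definition coact (R : comNzRingType) (A : comAlgType R) (n : nat)
    (M : 'M[A]_n) (v : 'I_n -> R) (i : 'I_n) : A :=
  \sum_(j < n) v j *: M i j.

Definition semi_invariant (R : comNzRingType) (A : comAlgType R) (n : nat)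
    (M : 'M[A]_n) (v : 'I_n -> R) : Prop :=
  exists theta : A, forall i, coact M v i = v i *: theta.

Definition semi_invariant_mod (R : comNzRingType) (A : comAlgType R)
    (pi : R) (m : nat) (n : nat) (M : 'M[A]_n) (v : 'I_n -> R) : Prop :=
  exists theta : A, forall i, exists b : A,
    coact M v i - v i *: theta = pi ^+ m *: b.

Definition prudent_rep (R : comNzRingType) (A : comAlgType R) (pi : R)
    (n : nat) (M : 'M[A]_n) : Prop :=
  forall v : 'I_n -> R,
    (forall k : nat, semi_invariant_mod pi k.+1 M v) -> semi_invariant M v.

Definition prudent (R : comNzRingType) (A : comAlgType R) (pi : R)
    (G : affine_group_scheme A) : Prop :=
  forall (n : nat) (M : 'M[A]_n), is_rep G M -> prudent_rep pi M.

Definition divisible_part (R : comNzRingType) (M : lmodType R) (pi : R)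
    (x : M) : Prop :=
  forall n : nat, exists y : M, x = pi ^+ n *: y.

(* Main.v *)
Require Import Defs.
From HB Require Import structures.
From mathcomp Require Import all_boot all_order all_algebra.
From mathcomp Require Import perm boolp.
Import GRing.Theory.
Local Open Scope ring_scope.
Local Open Scope quotient_scope.

Set Implicit Arguments. Unset Strict Implicit. Unset Printing Implicit Defensive.

(* Let d be the divisible part of A = R[G].  Any x in d is a matrix coefficient
   x = c M v of a representation M on R^n (Serre's local finiteness), and
   W = {v | c M v in d} is a saturated, hence free, submodule of R^n of some
   rank r.  Completeness of R (through Chevalley's theorem on decreasing
   sequences of submodules) shows that W is stable under G modulo every power
   of pi: if B is a basis of W and Theta the matrix read off M B in suitable
   coordinates, then M B = B Theta mod pi^m for all m.  So the line of maximal
   minors of B in the r-th tensor power of M is semi-invariant modulo every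
   pi^m, and by prudence it is semi-invariant.  Comparing minors gives
   M B = B Theta exactly.  As c B is the value of the counit on elements of d,
   it vanishes, and x = c M B u = (c B) Theta u = 0. *)

(** * Tensor products with a flat algebra *)

(** Congruences modulo every power of [pi] determine an element of [A] only up to [d], the very
    module to be shown zero, so they cannot simply be passed to the limit. Prudence supplies this
    passage, but for one vector at a time; replacing [W] by its line of minors brings a submodule of
    any rank within its reach. The tensor power is preferred to the exterior power because its
    matrix has products of entries of [M] as entries, without ordering or signs. Coming back from
    the line to [W] by Cramer's rule costs a factor [\det Theta], which has to be a unit: it is a
    character of [G]. Since [G] is given by its points, the comultiplication is the product of the
    two canonical points of the tensor square of [A]. Tensor products are encoded so that the
    vanishing of a sum of pure tensors can be read off as equations over [R]. *)

(** The relations are trivialised one at a time. Rewritten over the generators [w'], the next one is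
    a single relation in [M], to which flatness applies; the new change of generators multiplies the
    old coefficients on the right, so relations already trivial stay trivial. *)
Lemma flat_relations (R : comNzRingType) (M : lmodType R) (Mflat : flat_module M)
    (J : finType) (w : J -> M) (K : nat) (r : nat -> J -> R) :
  (forall k, (k < K)%N -> \sum_j r k j *: w j = 0) ->
  exists (J' : finType) (c : J -> J' -> R) (w' : J' -> M),
    (forall j, w j = \sum_j' c j j' *: w' j') /\
    (forall k, (k < K)%N -> forall j', \sum_j r k j * c j j' = 0).
Proof.
elim: K => [|K IH] rel0.
  exists J, (fun j j' => (j == j')%:R), w; split=> // j.
  rewrite (bigD1 j) //= eqxx scale1r big1 ?addr0 // => i /negPf ne.
  by rewrite eq_sym ne scale0r.
have [k ltk|J' [c [w' [w_def c0]]]] := IH; first exact/rel0/ltnW.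
pose r' (i : 'I_#|J'|) := \sum_j r K j * c j (enum_val i).
have [|m [a [y [y_def a0]]]] := Mflat #|J'| r' (fun i => w' (enum_val i)).
  rewrite -[RHS](rel0 K) //; under [RHS]eq_bigr do rewrite w_def scaler_sumr.
  rewrite exchange_big [RHS](big_enum_val (A := J')) /=; apply: eq_bigr => i _.
  by rewrite /r' scaler_suml; apply: eq_bigr => j _; rewrite scalerA.
exists 'I_m, (fun j q => \sum_(i < #|J'|) c j (enum_val i) * a i q), y; split.
  move=> j; rewrite w_def (big_enum_val (A := J')) /=.
  under eq_bigr do rewrite y_def scaler_sumr.
  rewrite exchange_big; apply: eq_bigr => q _; rewrite scaler_suml.
  by apply: eq_bigr => i _; rewrite scalerA.
have swap k q : \sum_j r k j * (\sum_(i < #|J'|) c j (enum_val i) * a i q)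
    = \sum_(i < #|J'|) (\sum_j r k j * c j (enum_val i)) * a i q.
  under eq_bigr do rewrite mulr_sumr.
  rewrite exchange_big; apply: eq_bigr => i _; rewrite mulr_suml.
  by apply: eq_bigr => j _; rewrite mulrA.
move=> k; rewrite ltnS leq_eqVlt => /predU1P[-> q|ltk q]; rewrite swap; first exact: a0.
by rewrite big1 // => i _; rewrite c0 ?mul0r.
Qed.

Definition scalars_inject (R : comNzRingType) (X : comAlgType R) : Prop :=
  forall a : R, a *: (1 : X) = 0 -> a = 0.

Section TensorModule.
Variables (R : comNzRingType) (X Z : comAlgType R).

Definition lcomb (J : finType) (w : J -> Z) (r : J -> R) : Z := \sum_j r j *: w j.

Definition lift_by (J : finType) (w : J -> Z) (u : seq (X * (J -> R))) : seq (X * Z) :=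
  [seq (p.1, lcomb w p.2) | p <- u].

Definition coefX (J : finType) (u : seq (X * (J -> R))) (j : J) : X :=
  \sum_(p <- u) p.2 j *: p.1.

(* Two formal sums of pure tensors are identified when both lift to
   X (x) R^J = X^J along a map R^J -> Z, with equal lifts.  For flat Z (a filtered
   colimit of finite free modules) this is equality in the tensor product. *)
Definition tens_rel (s t : seq (X * Z)) : Prop :=
  exists (J : finType) (w : J -> Z) (u v : seq (X * (J -> R))),
    [/\ s = lift_by w u, t = lift_by w v & coefX u =1 coefX v].

Lemma lift_exists s : exists (J : finType) (w : J -> Z) u, s = lift_by w u.
Proof.
exists 'I_(size s), (fun i => (tnth (in_tuple s) i).2).
exists [seq ((tnth (in_tuple s) i).1, fun j => (j == i)%:R) | i <- enum 'I_(size s)].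
rewrite /lift_by -map_comp -[LHS](map_tnth_enum (in_tuple s)); apply: eq_map => i /=.
rewrite /lcomb (bigD1 i) //= eqxx scale1r big1 ?addr0 => [|j /negPf->].
  by case: (tnth _ _).
by rewrite scale0r.
Qed.

Lemma tens_rel_refl s : tens_rel s s.
Proof. by have [J [w [u ->]]] := lift_exists s; exists J, w, u, u. Qed.

Lemma tens_rel_sym s t : tens_rel s t -> tens_rel t s.
Proof. by move=> [J [w [u [v [-> -> e]]]]]; exists J, w, v, u; split=> // j; rewrite e. Qed.

Definition ext_inl (J J' : finType) (p : X * (J -> R)) : X * (J + J' -> R) :=
  (p.1, fun j => if j is inl a then p.2 a else 0).
Definition ext_inr (J J' : finType) (p : X * (J' -> R)) : X * (J + J' -> R) :=
  (p.1, fun j => if j is inr a then p.2 a else 0).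
Definition join (J J' : finType) (w : J -> Z) (w' : J' -> Z) (j : J + J') : Z :=
  match j with inl a => w a | inr a => w' a end.

Lemma lift_inl (J J' : finType) (w : J -> Z) (w' : J' -> Z) u :
  lift_by (join w w') (map (@ext_inl J J') u) = lift_by w u.
Proof.
rewrite /lift_by -map_comp; apply: eq_map => p /=; congr pair.
by rewrite /lcomb big_sumType /= [X in _ + X]big1 ?addr0 // => j _; rewrite scale0r.
Qed.

Lemma lift_inr (J J' : finType) (w : J -> Z) (w' : J' -> Z) u :
  lift_by (join w w') (map (@ext_inr J J') u) = lift_by w' u.
Proof.
rewrite /lift_by -map_comp; apply: eq_map => p /=; congr pair.
by rewrite /lcomb big_sumType /= [X in X + _]big1 ?add0r // => j _; rewrite scale0r.
Qed.

Lemma coefX_cat (J : finType) (u v : seq (X * (J -> R))) j :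
  coefX (u ++ v) j = coefX u j + coefX v j.
Proof. by rewrite /coefX big_cat. Qed.

Lemma coefX_inl (J J' : finType) (u : seq (X * (J -> R))) j :
  coefX (map (@ext_inl J J') u) j = if j is inl a then coefX u a else 0.
Proof.
by rewrite /coefX big_map; case: j => a //=; rewrite big1 // => p _; rewrite scale0r.
Qed.

Lemma coefX_inr (J J' : finType) (u : seq (X * (J' -> R))) j :
  coefX (map (@ext_inr J J') u) j = if j is inr a then coefX u a else 0.
Proof.
by rewrite /coefX big_map; case: j => a //=; rewrite big1 // => p _; rewrite scale0r.
Qed.

Lemma lift_cat (J : finType) (w : J -> Z) u v :
  lift_by w (u ++ v) = lift_by w u ++ lift_by w v.
Proof. exact: map_cat. Qed.

Lemma tens_rel_cat s s' t t' :
  tens_rel s t -> tens_rel s' t' -> tens_rel (s ++ s') (t ++ t').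
Proof.
move=> [J [w [u [v [-> -> e]]]]] [J' [w' [u' [v' [-> -> e']]]]].
exists (J + J')%type, (join w w').
exists (map (@ext_inl J J') u ++ map (@ext_inr J J') u').
exists (map (@ext_inl J J') v ++ map (@ext_inr J J') v').
split; rewrite ?lift_cat ?lift_inl ?lift_inr //.
by move=> j; rewrite !coefX_cat !coefX_inl !coefX_inr; case: j => a; rewrite ?e ?e'.
Qed.

Lemma tens_rel_catC s t : tens_rel (s ++ t) (t ++ s).
Proof.
have [J [w [u ->]]] := lift_exists s; have [J' [w' [u' ->]]] := lift_exists t.
exists (J + J')%type, (join w w').
exists (map (@ext_inl J J') u ++ map (@ext_inr J J') u').
exists (map (@ext_inr J J') u' ++ map (@ext_inl J J') u).
split; rewrite ?lift_cat ?lift_inl ?lift_inr //.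
by move=> j; rewrite !coefX_cat addrC.
Qed.

Definition pscale (X' : lmodType R) (W : Type) (a : R) (s : seq (X' * W)) : seq (X' * W) :=
  [seq (a *: p.1, p.2) | p <- s].

Lemma lift_scale (J : finType) (w : J -> Z) a u :
  lift_by w (pscale a u) = pscale a (lift_by w u).
Proof. by rewrite /lift_by /pscale -!map_comp. Qed.

Lemma coefX_scale (J : finType) a (u : seq (X * (J -> R))) j :
  coefX (pscale a u) j = a *: coefX u j.
Proof.
rewrite /coefX big_map scaler_sumr; apply: eq_bigr => p _ /=.
by rewrite !scalerA mulrC.
Qed.

Lemma tens_rel_scale a s t : tens_rel s t -> tens_rel (pscale a s) (pscale a t).
Proof.
move=> [J [w [u [v [-> -> e]]]]]; exists J, w, (pscale a u), (pscale a v).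
by rewrite !lift_scale; split=> // j; rewrite !coefX_scale e.
Qed.

Lemma tens_relDscale a b s : tens_rel (pscale (a + b) s) (pscale a s ++ pscale b s).
Proof.
have [J [w [u ->]]] := lift_exists s.
exists J, w, (pscale (a + b) u), (pscale a u ++ pscale b u).
rewrite lift_cat !lift_scale; split=> // j.
by rewrite coefX_cat !coefX_scale scalerDl.
Qed.

Lemma tens_rel_scale0 s : tens_rel (pscale 0 s) [::].
Proof.
have [J [w [u ->]]] := lift_exists s.
exists J, w, (pscale 0 u), [::]; rewrite lift_scale; split=> // j.
by rewrite coefX_scale scale0r /coefX big_nil.
Qed.

Lemma tens_relDl x y z : tens_rel [:: (x + y, z)] [:: (x, z); (y, z)].
Proof.
exists unit, (fun=> z), [:: (x + y, fun=> 1)], [:: (x, fun=> 1); (y, fun=> 1)].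
rewrite /lift_by /= /lcomb big_const /= card_unit /= addr0 scale1r; split=> // j.
by rewrite /coefX !big_cons big_nil /= !scale1r !addr0.
Qed.

Lemma tens_relDr x z t : tens_rel [:: (x, z + t)] [:: (x, z); (x, t)].
Proof.
exists bool, (fun b : bool => if b then z else t), [:: (x, fun=> 1)],
  [:: (x, fun b : bool => b%:R : R); (x, fun b : bool => (~~ b)%:R : R)].
rewrite /lift_by /= /lcomb !big_bool /= !scale1r !scale0r addr0 add0r; split=> // j.
by rewrite /coefX !big_cons !big_nil !addr0; case: j; rewrite /= scale0r ?addr0 ?add0r.
Qed.

Lemma tens_relZ a x z : tens_rel [:: (x, a *: z)] [:: (a *: x, z)].
Proof.
exists unit, (fun=> z), [:: (x, fun=> a)], [:: (a *: x, fun=> 1)].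
rewrite /lift_by /= /lcomb !big_const /= card_unit /= !addr0 scale1r; split=> // j.
by rewrite /coefX !big_cons big_nil /= scale1r addr0.
Qed.

Definition recoef (J J' : finType) (c : J -> J' -> R) (p : X * (J -> R)) : X * (J' -> R) :=
  (p.1, fun q => \sum_j p.2 j * c j q).

Lemma lift_recoef (J J' : finType) (c : J -> J' -> R) (w : J -> Z) (w' : J' -> Z) u :
  (forall j, w j = \sum_q c j q *: w' q) ->
  lift_by w' (map (recoef c) u) = lift_by w u.
Proof.
move=> w_def; rewrite /lift_by -map_comp; apply: eq_map => p /=; congr pair.
rewrite /lcomb; under [RHS]eq_bigr do rewrite w_def scaler_sumr.
rewrite exchange_big; apply: eq_bigr => q _; rewrite scaler_suml.
by apply: eq_bigr => j _; rewrite scalerA.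
Qed.

Lemma coefX_recoef (J J' : finType) (c : J -> J' -> R) u q :
  coefX (map (recoef c) u) q = \sum_j c j q *: coefX u j.
Proof.
rewrite /coefX big_map; under [RHS]eq_bigr do rewrite scaler_sumr.
rewrite exchange_big; apply: eq_bigr => p _ /=; rewrite scaler_suml.
by apply: eq_bigr => j _; rewrite scalerA mulrC.
Qed.

(* Flatness turns two lifts of the same formal sum into equal ones. *)
Lemma tens_rel_trans (Zflat : flat_module Z) r s t :
  tens_rel s r -> tens_rel r t -> tens_rel s t.
Proof.
move=> [J [w [u [v [-> -> e]]]]] [J' [w' [v' [u' [eqv -> e']]]]].
have sz : size v = size v' by move/(congr1 size): eqv; rewrite !size_map.
pose p0 : X * (J -> R) := (0, fun=> 0); pose p0' : X * (J' -> R) := (0, fun=> 0).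
have nthE k : (k < size v)%N -> (nth p0 v k).1 = (nth p0' v' k).1
    /\ lcomb w (nth p0 v k).2 = lcomb w' (nth p0' v' k).2.
  move=> ltk; have := congr1 (fun l => nth (0, 0) l k) eqv.
  by rewrite (nth_map p0) // (nth_map p0') -?sz // => -[].
(* The [k]-th terms of the two lifts of the middle sum have the same image in [Z]. Trivialising
   these differences gives generators [w2] over which the two lifts coincide. *)
pose rel k (j : J + J') := match j with
  | inl a => (nth p0 v k).2 a | inr a => - (nth p0' v' k).2 a end.
have [k ltk|J2 [c [w2 [w2E c0]]]] := flat_relations Zflat (w := join w w') (K := size v) (r := rel).
  rewrite big_sumType /=; have [_] := nthE k ltk; rewrite /lcomb => ->.
  by under [X in _ + X]eq_bigr do rewrite scaleNr; rewrite sumrN subrr.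
pose cl j := c (inl j); pose cr j := c (inr j).
exists J2, w2, (map (recoef cl) u), (map (recoef cr) u'); split.
- by rewrite (lift_recoef u (w := w)) // => j; rewrite -w2E.
- by rewrite (lift_recoef u' (w := w')) // => j; rewrite -w2E.
move=> q; rewrite coefX_recoef; under eq_bigr do rewrite e.
rewrite -coefX_recoef [RHS]coefX_recoef; under [RHS]eq_bigr do rewrite -e'.
rewrite -coefX_recoef /coefX !big_map (big_nth p0) [RHS](big_nth p0') -sz.
rewrite !big_mkord; apply: eq_bigr => k _ /=.
have [-> _] := nthE k (ltn_ord k); congr (_ *: _).
have := c0 k (ltn_ord k) q; rewrite big_sumType /=.
under [X in _ + X]eq_bigr do rewrite mulNr.
by rewrite sumrN => /eqP; rewrite subr_eq0 => /eqP.
Qed.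

End TensorModule.

Section TensorQuotient.
Variables (R : comNzRingType) (X Z : comAlgType R) (Zflat : flat_module Z).

Definition tens_relb (s t : seq (X * Z)) : bool := `[< tens_rel s t >].

Lemma tens_relb_refl : reflexive tens_relb.
Proof. by move=> s; apply/asboolP/tens_rel_refl. Qed.

Lemma tens_relb_sym : symmetric tens_relb.
Proof. by move=> s t; apply/asboolP/asboolP; apply: tens_rel_sym. Qed.

Lemma tens_relb_trans : transitive tens_relb.
Proof. by move=> r s t /asboolP sr /asboolP rt; apply/asboolP/(tens_rel_trans Zflat sr rt). Qed.

Canonical tens_equiv := EquivRel tens_relb tens_relb_refl tens_relb_sym tens_relb_trans.

(* The second hypothesis keeps the tensor product algebra nontrivial. *)
Definition tensor (_ : scalars_inject X) := {eq_quot tens_equiv}.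
Variable Xinj : scalars_inject X.
Local Notation T := (tensor Xinj).

HB.instance Definition _ := Choice.on T.
HB.instance Definition _ := EqQuotient.on T.

Lemma tensorP s t : tens_rel s t <-> \pi_T s = \pi_T t.
Proof.
split=> [st|/eqmodP /asboolP //]; first by apply/eqmodP/asboolP.
Qed.

Definition tadd (p q : T) : T := \pi_T (repr p ++ repr q).
Definition tscale (a : R) (p : T) : T := \pi_T (pscale a (repr p)).

Lemma repr_rel s : tens_rel (repr (\pi_T s)) s.
Proof. by apply/tensorP; rewrite reprK. Qed.

Lemma taddE s t : tadd (\pi_T s) (\pi_T t) = \pi_T (s ++ t).
Proof. by apply/tensorP/tens_rel_cat; apply: repr_rel. Qed.

Lemma tscaleE a s : tscale a (\pi_T s) = \pi_T (pscale a s).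
Proof. by apply/tensorP/tens_rel_scale/repr_rel. Qed.

Lemma tensorW (P : T -> Prop) : (forall s, P (\pi_T s)) -> forall p, P p.
Proof. by move=> Ps p; rewrite -(reprK p). Qed.

Fact taddA : associative tadd.
Proof.
move=> p q r; move: p q r; do 3!elim/tensorW => ?.
by rewrite !taddE catA.
Qed.

Fact taddC : commutative tadd.
Proof.
move=> p q; move: p q; do 2!elim/tensorW => ?.
by rewrite !taddE; apply/tensorP/tens_rel_catC.
Qed.

Fact tadd0 : left_id (\pi_T [::]) tadd.
Proof. by elim/tensorW => s; rewrite taddE. Qed.

Fact tscaleDl p a b : tscale (a + b) p = tadd (tscale a p) (tscale b p).
Proof.
elim/tensorW: p => s; rewrite !tscaleE taddE; apply/tensorP/tens_relDscale.
Qed.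

Fact tscale0 p : tscale 0 p = \pi_T [::].
Proof. elim/tensorW: p => s; rewrite tscaleE; apply/tensorP/tens_rel_scale0. Qed.

Fact tscale1 : left_id 1 tscale.
Proof.
elim/tensorW => s; rewrite tscaleE; congr (\pi_T _).
by rewrite -[RHS]map_id; apply: eq_map => -[x z] /=; rewrite scale1r.
Qed.

Fact taddN : left_inverse (\pi_T [::]) (tscale (-1)) tadd.
Proof. by move=> p; rewrite -{2}[p]tscale1 -tscaleDl addNr tscale0. Qed.

HB.instance Definition _ := GRing.isZmodule.Build T taddA taddC tadd0 taddN.

Lemma pi_add s t : \pi_T s + \pi_T t = \pi_T (s ++ t).
Proof. exact: taddE. Qed.

Fact tscaleA a b p : tscale a (tscale b p) = tscale (a * b) p.
Proof.
elim/tensorW: p => s; rewrite !tscaleE; congr (\pi_T _).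
by rewrite /pscale -map_comp; apply: eq_map => t /=; rewrite scalerA.
Qed.

Fact tscaleDr : right_distributive tscale +%R.
Proof.
move=> a p q; move: p q; do 2!elim/tensorW => ?.
by rewrite pi_add !tscaleE pi_add /pscale map_cat.
Qed.

HB.instance Definition _ :=
  GRing.Zmodule_isLmodule.Build R T tscaleA tscale1 tscaleDr (fun p a b => tscaleDl p a b).

Lemma pi_scale a s : a *: \pi_T s = \pi_T (pscale a s).
Proof. exact: tscaleE. Qed.

Definition pure (x : X) (z : Z) : T := \pi_T [:: (x, z)].

Lemma pure_sum s : \pi_T s = \sum_(p <- s) pure p.1 p.2.
Proof.
elim: s => [|[x z] s IH]; first by rewrite big_nil.
by rewrite big_cons -IH /pure [RHS]pi_add.
Qed.

Lemma pureDl z : {morph pure^~ z : x y / x + y}.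
Proof. by move=> x y; rewrite /pure [RHS]pi_add; apply/tensorP/tens_relDl. Qed.

Lemma pureDr x : {morph pure x : y z / y + z}.
Proof. by move=> y z; rewrite /pure [RHS]pi_add; apply/tensorP/tens_relDr. Qed.

Lemma pureZl a x z : pure (a *: x) z = a *: pure x z.
Proof. by rewrite /pure [RHS]pi_scale. Qed.

Lemma pureZr a x z : pure x (a *: z) = a *: pure x z.
Proof. by rewrite -pureZl; apply/tensorP/tens_relZ. Qed.

Lemma pureNl x z : pure (- x) z = - pure x z.
Proof. by rewrite -scaleN1r pureZl scaleN1r. Qed.

Lemma pureNr x z : pure x (- z) = - pure x z.
Proof. by rewrite -scaleN1r pureZr scaleN1r. Qed.

Lemma pure0l z : pure 0 z = 0.
Proof. by rewrite -[0](scale0r 0) pureZl scale0r. Qed.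

Lemma pure0r x : pure x 0 = 0.
Proof. by rewrite -[0](scale0r 0) pureZr scale0r. Qed.

Lemma pure_suml (I : Type) (r : seq I) P (F : I -> X) z :
  pure (\sum_(i <- r | P i) F i) z = \sum_(i <- r | P i) pure (F i) z.
Proof. exact: (big_morph (pure^~ z) (pureDl z) (pure0l z)). Qed.

Lemma pure_sumr (I : Type) (r : seq I) P (F : I -> Z) x :
  pure x (\sum_(i <- r | P i) F i) = \sum_(i <- r | P i) pure x (F i).
Proof. exact: (big_morph (pure x) (pureDr x) (pure0r x)). Qed.

Lemma tensor_ind (P : T -> Prop) :
  P 0 -> (forall x z p, P p -> P (pure x z + p)) -> forall p, P p.
Proof.
move=> P0 PD p; rewrite -(reprK p) pure_sum.
by elim: (repr p) => [|[x z] s IH]; rewrite ?big_nil ?big_cons //; apply: PD.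
Qed.

Lemma tensor_sum (p : T) :
  exists (I : finType) (x : I -> X) (z : I -> Z), p = \sum_i pure (x i) (z i).
Proof.
exists 'I_(size (repr p)), (fun i => (tnth (in_tuple (repr p)) i).1),
  (fun i => (tnth (in_tuple (repr p)) i).2).
by rewrite -{1}(reprK p) pure_sum big_tnth.
Qed.

(** A lift of the empty sum is empty, so every [coefX] of the other lift vanishes. This criterion
    takes the place of exactness of the tensor product in the comodule arguments below. *)
Lemma pure_sum_eq0 (I : finType) (x : I -> X) (z : I -> Z) :
  \sum_i pure (x i) (z i) = 0 ->
  exists (J : finType) (s : I -> J -> R) (w : J -> Z),
    (forall i, z i = \sum_j s i j *: w j) /\ (forall j, \sum_i s i j *: x i = 0).
Proof.
move=> sum0; have: \pi_T [seq (x i, z i) | i <- enum I] = \pi_T [::].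
  by rewrite pure_sum big_map -[RHS]sum0 big_enum.
case/tensorP => J [w [u [v [uE v0 e]]]]; case: v => // in v0 e.
have sz : size u = #|I| by have := congr1 size uE; rewrite cardE /lift_by !size_map => <-.
pose p0 : X * (J -> R) := (0, fun=> 0).
have nthE i : x i = (nth p0 u (enum_rank i)).1 /\ z i = lcomb w (nth p0 u (enum_rank i)).2.
  have lti : (enum_rank i < size u)%N by rewrite sz.
  have := congr1 (fun l => nth (0, 0) l (enum_rank i)) uE.
  rewrite (nth_map p0) // (nth_map i) -?cardE // -(enum_val_nth i) enum_rankK.
  by case.
exists J, (fun i => (nth p0 u (enum_rank i)).2), w; split=> [i|j].
  by have [_ ->] := nthE i.
have := e j; rewrite /coefX big_nil => coef0; apply: (etrans _ coef0).
rewrite (big_nth p0) big_mkord sz [RHS](reindex enum_rank) /=; last first.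
  by apply: onW_bij; apply: enum_rank_bij.
by apply: eq_bigr => i _; have [<- _] := nthE i.
Qed.

Section Lift.
Variables (N : lmodType R) (f : X -> Z -> N).
Hypotheses (fDl : forall z, {morph f^~ z : x y / x + y})
  (fDr : forall x, {morph f x : y z / y + z})
  (fZl : forall a x z, f (a *: x) z = a *: f x z)
  (fZr : forall a x z, f x (a *: z) = a *: f x z).

Definition tlift (p : T) : N := \sum_(t <- repr p) f t.1 t.2.

(** Independence of the representative: by bilinearity the value on a lift depends on it only
    through [coefX], on which related sums agree. *)
Lemma tlift_pi s : tlift (\pi_T s) = \sum_(t <- s) f t.1 t.2.
Proof.
have fs0l z : f 0 z = 0 by rewrite -[0](scale0r 0) fZl scale0r.
have fs0r x : f x 0 = 0 by rewrite -[0](scale0r 0) fZr scale0r.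
have [J [w [u [v [eu ev e]]]]] := repr_rel s.
have liftE u' : \sum_(t <- lift_by w u') f t.1 t.2 = \sum_j f (coefX u' j) (w j).
  rewrite big_map; under [RHS]eq_bigr => j _.
    rewrite (big_morph (f^~ (w j)) (fDl (w j)) (fs0l _)); over.
  rewrite exchange_big; apply: eq_bigr => p _ /=.
  rewrite (big_morph (f p.1) (fDr p.1) (fs0r _)).
  by apply: eq_bigr => j _; rewrite fZl fZr.
by rewrite /tlift eu ev !liftE; apply: eq_bigr => j _; rewrite e.
Qed.

Lemma tlift_pure x z : tlift (pure x z) = f x z.
Proof. by rewrite tlift_pi big_seq1. Qed.

Lemma tliftD : {morph tlift : p q / p + q}.
Proof.
move=> p q; move: p q; do 2!elim/tensorW => ?.
by rewrite pi_add !tlift_pi big_cat.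
Qed.

Lemma tliftZ a p : tlift (a *: p) = a *: tlift p.
Proof.
elim/tensorW: p => s; rewrite pi_scale !tlift_pi big_map scaler_sumr.
by apply: eq_bigr => t _; rewrite fZl.
Qed.

End Lift.

End TensorQuotient.

Section TensorAlgebra.
Variables (R : comNzRingType) (X Z : comAlgType R) (Zflat : flat_module Z).
Variable Xinj : scalars_inject X.
Local Notation T := (tensor Zflat Xinj).
Local Notation pure := (pure Zflat Xinj).

Definition mul_pure (x : X) (z : Z) (q : T) : T :=
  tlift (fun y t => pure (x * y) (z * t)) q.

Lemma mul_pureE x z y t : mul_pure x z (pure y t) = pure (x * y) (z * t).
Proof.
apply: tlift_pure; repeat intro; by rewrite /= ?mulrDr ?pureDl ?pureDr -?scalerAr ?pureZl ?pureZr.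
Qed.

Lemma mul_pureD x z : {morph mul_pure x z : p q / p + q}.
Proof.
apply: tliftD; repeat intro; by rewrite /= ?mulrDr ?pureDl ?pureDr -?scalerAr ?pureZl ?pureZr.
Qed.

Lemma mul_pureZ x z a p : mul_pure x z (a *: p) = a *: mul_pure x z p.
Proof.
apply: tliftZ; repeat intro; by rewrite /= ?mulrDr ?pureDl ?pureDr -?scalerAr ?pureZl ?pureZr.
Qed.

Lemma mul_pure0 x z : mul_pure x z 0 = 0.
Proof. by rewrite -{1}(scale0r (0 : T)) mul_pureZ scale0r. Qed.

Definition tmul (p q : T) : T := tlift (fun x z => mul_pure x z q) p.

Let mul_pure_bilin (q : T) :
  [/\ forall z, {morph (fun x => mul_pure x z q) : x y / x + y},
      forall x, {morph (fun z => mul_pure x z q) : y z / y + z},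
      forall a x z, mul_pure (a *: x) z q = a *: mul_pure x z q &
      forall a x z, mul_pure x (a *: z) q = a *: mul_pure x z q].
Proof.
split=> [z x y|x y z|a x z|a x z]; elim/tensor_ind: q => [|x' z' q IH];
  rewrite ?mul_pure0 ?addr0 ?scaler0 // !mul_pureD !mul_pureE IH.
- by rewrite mulrDl pureDl addrACA.
- by rewrite mulrDl pureDr addrACA.
- by rewrite -scalerAl pureZl scalerDr.
- by rewrite -scalerAl pureZr scalerDr.
Qed.

Lemma tmul_pure x z q : tmul (pure x z) q = mul_pure x z q.
Proof. by have [*] := mul_pure_bilin q; apply: tlift_pure. Qed.

Fact tmulDl : left_distributive tmul +%R.
Proof. by move=> p p' q; have [*] := mul_pure_bilin q; apply: tliftD. Qed.

Fact tmulZl a p q : a *: tmul p q = tmul (a *: p) q.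
Proof. by have [*] := mul_pure_bilin q; apply/esym/tliftZ. Qed.

Lemma tmul0l q : tmul 0 q = 0.
Proof. by rewrite -{1}(scale0r (0 : T)) -tmulZl scale0r. Qed.

Lemma tmulDr : right_distributive tmul +%R.
Proof.
move=> p q q'; elim/tensor_ind: p => [|x z p IH]; first by rewrite !tmul0l addr0.
by rewrite !tmulDl IH !tmul_pure mul_pureD addrACA.
Qed.

Lemma tmul0r p : tmul p 0 = 0.
Proof. by apply: (addrI (tmul p 0)); rewrite -tmulDr !addr0. Qed.

Fact tmulC : commutative tmul.
Proof.
elim/tensor_ind => [|x z p IH] q; first by rewrite tmul0l tmul0r.
rewrite tmulDl tmulDr -IH; congr (_ + _).
elim/tensor_ind: q => [|y t q IHq]; first by rewrite tmul0l tmul0r.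
by rewrite tmulDl tmulDr -IHq !tmul_pure !mul_pureE mulrC [z * t]mulrC.
Qed.

Fact tmulA : associative tmul.
Proof.
elim/tensor_ind => [|x z p IH] q r; first by rewrite !tmul0l.
rewrite !tmulDl IH; congr (_ + _).
elim/tensor_ind: q => [|y t q IHq]; first by rewrite tmul0l !tmul0r tmul0l.
rewrite !tmulDl !tmulDr tmulDl IHq; congr (_ + _).
elim/tensor_ind: r {IHq} => [|y' t' r IHr]; first by rewrite !tmul0r.
by rewrite !tmulDr IHr !tmul_pure !mul_pureE !tmul_pure !mul_pureE !mulrA.
Qed.

Fact tmul1 : left_id (pure 1 1) tmul.
Proof.
elim/tensor_ind => [|x z p IH]; first by rewrite tmul0r.
by rewrite tmulDr IH tmul_pure mul_pureE !mul1r.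
Qed.

(** Otherwise the vanishing criterion writes [1 : Z] with coefficients that kill [1 : X], and these
    are zero by [Xinj]. *)
Fact pure1_neq0 : pure 1 1 != 0.
Proof.
apply/eqP => pure0.
have [|J [s [w [wE s0]]]] := @pure_sum_eq0 _ _ _ Zflat Xinj unit (fun=> 1) (fun=> 1).
  by rewrite big_const card_unit /= addr0.
have := oner_neq0 Z; rewrite (wE tt) big1 ?eqxx // => j _.
have := s0 j; rewrite (bigD1 tt) //= big1 ?addr0 => [/Xinj ->|[] //].
by rewrite scale0r.
Qed.

HB.instance Definition _ :=
  GRing.Zmodule_isComNzRing.Build T tmulA tmulC tmul1 tmulDl pure1_neq0.
HB.instance Definition _ := GRing.Lmodule_isLalgebra.Build R T tmulZl.
HB.instance Definition _ := GRing.Lalgebra_isComAlgebra.Build R T.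

Lemma pureM x y z t : pure x z * pure y t = pure (x * y) (z * t).
Proof. by rewrite -[LHS]/(tmul _ _) tmul_pure mul_pureE. Qed.

Lemma pure_split x z : pure x z = pure x 1 * pure 1 z.
Proof. by rewrite pureM mul1r mulr1. Qed.

Definition tinl (x : X) : T := pure x 1.
Definition tinr (z : Z) : T := pure 1 z.

Fact tinl_linear : linear tinl.
Proof. by move=> a x y; rewrite /tinl pureDl pureZl. Qed.
Fact tinl_monoid : monoid_morphism tinl.
Proof. by split=> // x y; rewrite /tinl pureM mulr1. Qed.
HB.instance Definition _ := GRing.isLinear.Build R X T *:%R tinl tinl_linear.
HB.instance Definition _ := GRing.isMonoidMorphism.Build X T tinl tinl_monoid.

Fact tinr_linear : linear tinr.
Proof. by move=> a x y; rewrite /tinr pureDr pureZr. Qed.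
Fact tinr_monoid : monoid_morphism tinr.
Proof. by split=> // x y; rewrite /tinr pureM mulr1. Qed.
HB.instance Definition _ := GRing.isLinear.Build R Z T *:%R tinr tinr_linear.
HB.instance Definition _ := GRing.isMonoidMorphism.Build Z T tinr tinr_monoid.

Section Pairing.
Variables (B : comAlgType R) (g : {lrmorphism X -> B}) (h : {lrmorphism Z -> B}).

Definition tpair (p : T) : B := tlift (fun x z => g x * h z) p.

Lemma tpair_pure x z : tpair (pure x z) = g x * h z.
Proof.
apply: tlift_pure; repeat intro; by rewrite /= ?rmorphD ?mulrDl ?mulrDr ?linearZ -?scalerAl -?scalerAr.
Qed.

Fact tpair_linear : linear tpair.
Proof.
move=> a p q; rewrite /tpair tliftD ?tliftZ //; repeat intro;
  by rewrite /= ?rmorphD ?mulrDl ?mulrDr ?linearZ -?scalerAl -?scalerAr.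
Qed.
HB.instance Definition _ := GRing.isLinear.Build R T B *:%R tpair tpair_linear.

Let tpairD p q : tpair (p + q) = tpair p + tpair q. Proof. exact: linearD. Qed.
Let tpair0 : tpair 0 = 0. Proof. exact: linear0. Qed.

Fact tpair_monoid : monoid_morphism tpair.
Proof.
split=> [|p q]; first by rewrite tpair_pure !rmorph1 mulr1.
elim/tensor_ind: p => [|x z p IH]; first by rewrite mul0r tpair0 mul0r.
rewrite mulrDl !tpairD IH mulrDl; congr (_ + _).
elim/tensor_ind: q {IH} => [|y t q IHq]; first by rewrite mulr0 tpair0 mulr0.
by rewrite mulrDr !tpairD IHq mulrDr pureM !tpair_pure !rmorphM mulrACA.
Qed.
HB.instance Definition _ := GRing.isMonoidMorphism.Build T B tpair tpair_monoid.

Lemma tpair_inl x : tpair (tinl x) = g x.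
Proof. by rewrite tpair_pure rmorph1 mulr1. Qed.

Lemma tpair_inr z : tpair (tinr z) = h z.
Proof. by rewrite tpair_pure rmorph1 mul1r. Qed.

End Pairing.

End TensorAlgebra.

(** * Modules over a discrete valuation ring *)

Section DVR.
Variables (R : idomainType) (pi : R).
Hypothesis Hdvr : is_dvr_uniformizer pi.

Definition torsion_free (M : lmodType R) : Prop :=
  forall (r : R) (x : M), r *: x = 0 -> r != 0 -> x = 0.

Lemma flat_torsion_free (M : lmodType R) : flat_module M -> torsion_free M.
Proof.
move=> flatM r x rx0 r_neq0.
have [|m [a [y [xE ra0]]]] := flatM 1 (fun=> r) (fun=> x); first by rewrite big_ord1.
rewrite (xE ord0) big1 // => j _.
have /eqP := ra0 j; rewrite big_ord1 mulf_eq0 (negPf r_neq0) => /eqP ->.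
exact: scale0r.
Qed.

Lemma torsion_free_inj (M : lmodType R) r (x y : M) :
  torsion_free M -> r != 0 -> r *: x = r *: y -> x = y.
Proof.
move=> tfM r0 rxy; apply/eqP; rewrite -subr_eq0; apply/eqP/(tfM r) => //.
by rewrite scalerBr rxy subrr.
Qed.

(** The divisor is an element of least valuation. [P] is a bare predicate because it stands both for
    a set of leading coefficients and for the entries of a vector. *)
Lemma dvr_min (P : R -> Prop) : (exists2 c, P c & c != 0) ->
  exists c, [/\ P c, c != 0 & forall c', P c' -> exists t, c' = c * t].
Proof.
have [pi0 _ valR] := Hdvr => exP.
pose Q k := `[< exists2 u, u \is a GRing.unit & P (u * pi ^+ k) >].
have [k /asboolP[u Uu Pu] mink] : exists2 k, Q k & forall k', Q k' -> (k <= k')%N.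
  have exQ : exists k, Q k.
    have [c Pc c0] := exP; have [k [u [Uu cE]]] := valR c c0.
    by exists k; apply/asboolP; exists u; rewrite -?cE.
  by case: (ex_minnP exQ) => k Qk mink; exists k.
exists (u * pi ^+ k); split=> //.
  by rewrite mulf_neq0 ?expf_neq0 //; apply: contraTneq Uu => ->; rewrite unitr0.
move=> c' Pc'; have [->|c'0] := eqVneq c' 0; first by exists 0; rewrite mulr0.
have [k' [u' [Uu' c'E]]] := valR c' c'0.
have lekk' : (k <= k')%N by apply/mink/asboolP; exists u'; rewrite -?c'E.
exists (u^-1 * u' * pi ^+ (k' - k)).
by rewrite c'E -{1}(subnKC lekk') exprD mulrACA mulVKr // mulrA.
Qed.

Lemma primitive_part (n : nat) (v : 'I_n -> R) i : v i != 0 ->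
  exists (i0 : 'I_n) (t : 'I_n -> R), [/\ v i0 != 0, t i0 = 1 & forall j, v j = v i0 * t j].
Proof.
move=> vi0; have [|c [[i0 <-] c0 cmin]] := @dvr_min (fun c => exists j, v j = c).
  by exists (v i) => //; exists i.
have /choice[t tE] : forall j, exists t, v j = v i0 * t by move=> j; apply: cmin; exists j.
by exists i0, t; split=> //; apply: (mulfI c0); rewrite -tE mulr1.
Qed.

Section Modules.
Variable M : lmodType R.

Definition submodule (V : M -> Prop) : Prop :=
  forall a x y, V x -> V y -> V (a *: x + y).

Definition generated_by (V : M -> Prop) (m : nat) : Prop :=
  exists g : 'I_m -> M, (forall i, V (g i)) /\
    (forall x, V x -> exists r : 'I_m -> R, x = \sum_i r i *: g i).

(** Induction on the number of spanning vectors: [lead] collects the possible coefficients of [a n]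
    on [V], and an element [y] realising the least valuation completes generators of the part of [V]
    spanned by the earlier vectors. [lead] is a relation because the [a i] may be dependent. *)
Lemma noetherian (V : M -> Prop) (a : nat -> M) n : submodule V ->
  (forall x, V x -> exists r : nat -> R, x = \sum_(i < n) r i *: a i) ->
  exists m, generated_by V m.
Proof.
elim: n V => [|n IH] V subV spanV.
  exists 0%N, (fun=> 0); split=> [[]//|x /spanV[r ->]].
  by exists (fun=> 0); rewrite !big_ord0.
pose span x := exists r : nat -> R, x = \sum_(i < n) r i *: a i.
pose lead c := exists2 x, V x & span (x - c *: a n).
have leadV x : V x -> exists2 c, lead c & span (x - c *: a n).
  move=> Vx; have [r xE] := spanV x Vx; exists (r n).
    by exists x => //; exists r; rewrite xE big_ord_recr addrK.
  by exists r; rewrite xE big_ord_recr addrK.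
have [lead0|/existsNP[c0 /not_implyP[leadc0 /eqP c0_neq0]]] := pselect (forall c, lead c -> c = 0).
  by apply: IH => // x /leadV[c /lead0-> [r]]; rewrite scale0r subr0 => ->; exists r.
have [|c [[y Vy [ry yE]] c_neq0 cmin]] := @dvr_min lead; first by exists c0.
have [|x|m [g [Vg gspan]]] := IH (fun x => V x /\ span x).
- move=> b x z [Vx [r xE]] [Vz [s zE]]; split; first exact: subV.
  exists (fun i => b * r i + s i); rewrite xE zE scaler_sumr -big_split.
  by apply: eq_bigr => i _; rewrite scalerDl scalerA.
- by case.
exists m.+1, (fun i => oapp g y (unlift ord_max i)); split.
  move=> i; case: unliftP => [j|] _ //=; exact: (Vg j).1.
move=> x Vx; have [d /cmin[t dE] [r xE]] := leadV x Vx.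
have [|s sE] := gspan (x - t *: y).
  split; first by rewrite addrC -scaleNr; apply: subV.
  exists (fun i => r i - t * ry i).
  under eq_bigr do rewrite scalerBl -scalerA.
  rewrite sumrB -scaler_sumr -xE -yE scalerBr opprB scalerA [t * c]mulrC -dE.
  by rewrite addrA subrK.
exists (fun i => oapp s t (unlift ord_max i)).
rewrite big_ord_recr /= unlift_none /=; apply/eqP; rewrite -subr_eq sE; apply/eqP.
apply: eq_bigr => i _.
have -> : widen_ord (leqnSn m) i = lift ord_max i by apply/val_inj; rewrite /= /bump leqNgt ltn_ord.
by rewrite liftK.
Qed.

(** A generating family of minimal size is a basis: a nontrivial relation, divided by its
    coefficient of least valuation, has a coefficient 1 and makes one generator redundant. *)
Lemma free_basis (V : M -> Prop) : torsion_free M -> (exists m, generated_by V m) ->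
  exists (m : nat) (g : 'I_m -> M), [/\ forall i, V (g i),
    forall x, V x -> exists r : 'I_m -> R, x = \sum_i r i *: g i &
    forall r : 'I_m -> R, \sum_i r i *: g i = 0 -> forall i, r i = 0].
Proof.
move=> tfM [m0 gen0]; have exg : exists m, `[< generated_by V m >].
  by exists m0; apply/asboolP.
case: (ex_minnP exg) => m /asboolP[g [Vg gspan]] mmin; exists m, g; split=> // r r0 i.
apply/eqP; apply: contraT => /primitive_part[i0 [t [ri0 ti0 rE]]].
have t0 : \sum_i t i *: g i = 0.
  apply: (torsion_free_inj (r := r i0)) => //; rewrite scaler0; apply: (etrans _ r0).
  rewrite scaler_sumr.
  by apply: eq_bigr => j _; rewrite scalerA -rE.
case: m i0 => [[]//|m] i0 in g Vg gspan mmin r r0 i t ri0 ti0 rE t0 *.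
suff : generated_by V m by move/asboolP/mmin; rewrite ltnn.
exists (fun j => g (lift i0 j)); split=> // x /gspan[s ->].
exists (fun j => s (lift i0 j) - s i0 * t (lift i0 j)).
under [RHS]eq_bigr do rewrite scalerBl -scalerA.
rewrite sumrB -scaler_sumr.
move/eqP: t0; rewrite (bigD1_ord i0) //= ti0 scale1r addr_eq0 => /eqP gi0.
by rewrite (bigD1_ord i0) //= gi0 scalerN addrC.
Qed.

End Modules.
End DVR.

(** * Comultiplication from the functor of points *)

(** [gmul] takes bundled morphisms, so pointwise equal points must be made equal before one replaces
    the other. *)
Lemma lrmorphism_ext (R : comNzRingType) (A B : comAlgType R) (f g : pts A B) :
  f =1 g -> f = g.
Proof.
case: f g => f cf [g cg] /= /funext fg; case: g / fg cg => cg; congr GRing.LRMorphism.Pack.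
case: cf cg => [[c1] [c2] [c3]] [[d1] [d2] [d3]].
by rewrite (Prop_irrelevance c1 d1) (Prop_irrelevance c2 d2) (Prop_irrelevance c3 d3).
Qed.

(** Naturality along this structure map reduces the unit of [G] over any [B] to the counit. *)
Definition scalar_map (R : comNzRingType) (B : comAlgType R) (r : R^o) : B := (r : R)%:A.

Section ScalarMap.
Variables (R : comNzRingType) (B : comAlgType R).
Fact scalar_map_linear : linear (@scalar_map R B).
Proof. by move=> a x y; rewrite /scalar_map scalerDl scalerA. Qed.
Fact scalar_map_monoid : monoid_morphism (@scalar_map R B).
Proof.
by split=> [|x y]; rewrite /scalar_map ?scale1r // -scalerAl mul1r scalerA.
Qed.
HB.instance Definition _ :=
  GRing.isLinear.Build R R^o B *:%R (@scalar_map R B) scalar_map_linear.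
HB.instance Definition _ :=
  GRing.isMonoidMorphism.Build R^o B (@scalar_map R B) scalar_map_monoid.
End ScalarMap.

Lemma tensor_sum_family (R : comNzRingType) (X Z : comAlgType R) (Zflat : flat_module Z)
    (Xinj : scalars_inject X) (K : Type) (p : K -> tensor Zflat Xinj) :
  exists (I : K -> finType) (x : forall k, I k -> X) (z : forall k, I k -> Z),
    forall k, p k = \sum_i pure Zflat Xinj (x k i) (z k i).
Proof.
pose E k := cid (tensor_sum (p k)); pose F k := cid (projT2 (E k)).
exists (fun k => projT1 (E k)), (fun k => projT1 (F k)).
exists (fun k => projT1 (cid (projT2 (F k)))) => k.
exact: (projT2 (cid (projT2 (F k)))).
Qed.

Section Comultiplication.
Variables (R : idomainType) (A : comAlgType R) (G : affine_group_scheme A).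
Hypothesis Aflat : flat_module A.

Definition counit (x : A) : R := gone G R^o x.

Lemma goneE (B : comAlgType R) x : gone G B x = (counit x)%:A.
Proof. by rewrite -(gone_natural G (@scalar_map R B : {lrmorphism R^o -> B})). Qed.

Lemma counitZ a x : counit (a *: x) = a * counit x.
Proof. by rewrite /counit linearZ. Qed.

(** The counit retracts the structure map of [A]. *)
Lemma coord_scalars_inject : scalars_inject A.
Proof.
move=> a a0; have := counitZ a 1; rewrite a0 /counit rmorph1 mulr1 => <-.
exact: rmorph0.
Qed.

Local Notation T2 := (tensor Aflat coord_scalars_inject).
Local Notation pure2 := (pure Aflat coord_scalars_inject).

Lemma tensor2_scalars_inject : scalars_inject T2.
Proof.
move=> a a0; pose f : {lrmorphism T2 -> R^o} := tpair (gone G R^o) (gone G R^o).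
have : f (a *: 1) = a *: f 1 by rewrite linearZ.
by rewrite a0 rmorph0 rmorph1 -[RHS]/(a * 1) mulr1.
Qed.

Local Notation T3 := (tensor Aflat tensor2_scalars_inject).
Local Notation pure3 := (pure Aflat tensor2_scalars_inject).

(** Yoneda: every pair of points [g], [h] is the image under [tpair g h] of the canonical pair used
    here, so by naturality this one product determines all products. *)
Definition comul : {lrmorphism A -> T2} := gmul G (tinl Aflat _ : pts A T2) (tinr _ _ : pts A T2).

Lemma gmulE (B : comAlgType R) (g h : pts A B) x : gmul G g h x = tpair g h (comul x).
Proof.
have := gmul_natural G (tpair g h : {lrmorphism T2 -> B}) (tinl _ _ : pts A T2) (tinr _ _ : pts A T2) x.
rewrite /= => ->; congr (gmul G _ _ x).
  by apply: lrmorphism_ext => y /=; rewrite tpair_inl.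
by apply: lrmorphism_ext => y /=; rewrite tpair_inr.
Qed.

Lemma gmul_sum (B : comAlgType R) (g h : pts A B) x (I : finType) (a b : I -> A) :
  comul x = \sum_i pure2 (a i) (b i) -> gmul G g h x = \sum_i g (a i) * h (b i).
Proof.
move=> xE; rewrite gmulE xE raddf_sum; apply: eq_bigr => i _.
exact: tpair_pure.
Qed.

Lemma counitl x (I : finType) (a b : I -> A) :
  comul x = \sum_i pure2 (a i) (b i) -> x = \sum_i counit (a i) *: b i.
Proof.
move=> xE; rewrite -[LHS](gmul1g G (idfun : pts A A) x) (gmul_sum _ _ xE).
by apply: eq_bigr => i _ /=; rewrite goneE -scalerAl mul1r.
Qed.

Lemma counitr x (I : finType) (a b : I -> A) :
  comul x = \sum_i pure2 (a i) (b i) -> x = \sum_i counit (b i) *: a i.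
Proof.
move=> xE; rewrite -[LHS](gmulg1 G (idfun : pts A A) x) (gmul_sum _ _ xE).
by apply: eq_bigr => i _ /=; rewrite goneE -scalerAr mulr1.
Qed.

Let l1 : pts A T3 := tinl _ _ \o tinl _ _.
Let l2 : pts A T3 := tinl _ _ \o tinr _ _.
Let l3 : pts A T3 := tinr _ _.

Lemma gmul_l1_l2 x : gmul G l1 l2 x = tinl _ tensor2_scalars_inject (comul x).
Proof.
exact/esym/(gmul_natural G (tinl _ _ : {lrmorphism T2 -> T3}) (tinl _ _ : pts A T2) (tinr _ _ : pts A T2) x).
Qed.

(** This is the associative law for the three canonical points [l1], [l2], [l3] of the triple tensor
    product, evaluated at [x]. *)
Lemma coassociativity x (I : finType) (a b : I -> A) (Q : I -> finType)
    (c d : forall i, Q i -> A) :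
  comul x = \sum_i pure2 (a i) (b i) ->
  (forall i, comul (b i) = \sum_q pure2 (c i q) (d i q)) ->
  \sum_i pure3 (comul (a i)) (b i) = \sum_i \sum_q pure3 (pure2 (a i) (c i q)) (d i q).
Proof.
move=> xE bE; have := gmulA G l1 l2 l3 x; rewrite !(gmul_sum _ _ xE).
under eq_bigr => i _ do rewrite (gmul_sum _ _ (bE i)) mulr_sumr.
under [RHS]eq_bigr => i _ do rewrite gmul_l1_l2 -[X in X * _]/(pure3 _ _) -pure_split.
move=> <-; apply: eq_bigr => i _; apply: eq_bigr => q _.
by rewrite /l1 /l2 /l3 /= /tinl /tinr mulrA pureM mulr1 -pure_split -pure_split.
Qed.

Lemma comulZ r x : comul (r *: x) = r *: comul x.
Proof. exact: linearZ. Qed.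

Lemma comulD x y : comul (x + y) = comul x + comul y.
Proof. exact: raddfD. Qed.

Lemma comul_sum (I : finType) (f : I -> A) : comul (\sum_i f i) = \sum_i comul (f i).
Proof. exact: raddf_sum. Qed.

Definition lcomodule (I : finType) (a : I -> A) (x : A) : Prop :=
  exists b : I -> A, comul x = \sum_i pure2 (a i) (b i).

Lemma lcomodule_submodule (I : finType) (a : I -> A) : submodule (lcomodule a).
Proof.
move=> r x y [b xE] [b' yE]; exists (fun i => r *: b i + b' i).
rewrite comulD comulZ xE yE scaler_sumr -big_split; apply: eq_bigr => i _.
by rewrite pureDr pureZr.
Qed.

(* Serre's argument: {x | Delta x in F (x) A} is a subcomodule for every
   submodule F of A. *)
Lemma lcomodule_stable (I : finType) (a : I -> A) x : lcomodule a x ->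
  exists (J : finType) (f w : J -> A),
    (forall j, lcomodule a (f j)) /\ comul x = \sum_j pure2 (f j) (w j).
Proof.
move=> [b xE]; have [Q [c [d bE]]] := tensor_sum_family (fun i => comul (b i)).
have /eqP := coassociativity xE bE; rewrite sig_big_dep /= -subr_eq0 -sumrN.
(* Both sides of coassociativity go into one sum, so that the criterion expresses all right factors
   through common [w j]. Its [j]-th relation then computes the comultiplication of the [j]-th left
   factor, with first factors among the [a i]. *)
pose x3 (k : I + {i : I & Q i}) : T2 := match k with
  inl i => comul (a i) | inr p => - pure2 (a (tag p)) (c _ (tagged p)) end.
pose z3 (k : I + {i : I & Q i}) : A := match k with
  inl i => b i | inr p => d _ (tagged p) end.
have -> : \sum_i pure3 (comul (a i)) (b i) +
    \sum_(p : {i : I & Q i}) - pure3 (pure2 (a (tag p)) (c _ (tagged p))) (d _ (tagged p))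
    = \sum_k pure3 (x3 k) (z3 k).
  rewrite big_sumType /=; congr (_ + _); apply: eq_bigr => p _.
  by rewrite -scaleN1r -pureZl scaleN1r.
move=> /eqP/pure_sum_eq0[J [s [w [z3E s0]]]].
exists J, (fun j => \sum_i s (inl i) j *: a i), w; split=> [j|].
  pose tg i (q : Q i) : {i : I & Q i} := existT _ i q.
  exists (fun i => \sum_q s (inr (tg i q)) j *: c i q).
  have /eqP := s0 j; rewrite big_sumType /= addr_eq0 => /eqP.
  under eq_bigr do rewrite -comulZ; rewrite -comul_sum => ->; rewrite -sumrN.
  under [RHS]eq_bigr do rewrite pure_sumr.
  rewrite [RHS]sig_big_dep /=; apply: eq_bigr => -[i q] _ /=.
  by rewrite scalerN opprK pureZr.
rewrite xE; under [RHS]eq_bigr do rewrite pure_suml.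
rewrite exchange_big; apply: eq_bigr => i _.
rewrite -[b i]/(z3 (inl i)) z3E pure_sumr; apply: eq_bigr => j _.
by rewrite pureZl pureZr.
Qed.

End Comultiplication.

(** * Matrix coefficients *)

Section MatrixCoefficients.
Variables (R : idomainType) (pi : R) (Hdvr : is_dvr_uniformizer pi).
Variables (A : comAlgType R) (G : affine_group_scheme A) (Aflat : flat_module A).

Local Notation T2 := (tensor Aflat (@coord_scalars_inject R A G)).
Local Notation pure2 := (pure Aflat (@coord_scalars_inject R A G)).
Local Notation T3 := (tensor Aflat (@tensor2_scalars_inject R A G Aflat)).
Local Notation pure3 := (pure Aflat (@tensor2_scalars_inject R A G Aflat)).
Local Notation comul := (comul G Aflat).

Definition independent (n : nat) (e : 'I_n -> A) : Prop :=
  forall r : 'I_n -> R, \sum_i r i *: e i = 0 -> forall i, r i = 0.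

(** Each column of the coefficients [s] given by the criterion is a relation among the [e k], hence
    zero. *)
Lemma pure2_independent n (e y : 'I_n -> A) : independent e ->
  \sum_k pure2 (e k) (y k) = 0 -> forall k, y k = 0.
Proof.
move=> inde /pure_sum_eq0[J [s [w [yE s0]]]] k; rewrite yE big1 // => j _.
by rewrite (inde (s^~ j) (s0 j)) scale0r.
Qed.

(** The criterion in the last factor leaves relations in the tensor square, from which
    [pure2_independent] cancels the [e k]. *)
Lemma pure3_independent n (e : 'I_n -> A) (I : 'I_n -> finType)
    (c d : forall k, I k -> A) : independent e ->
  \sum_k \sum_i pure3 (pure2 (e k) (c k i)) (d k i) = 0 ->
  forall k, \sum_i pure2 (c k i) (d k i) = 0.
Proof.
move=> inde; rewrite sig_big_dep /=.
case/(pure_sum_eq0 (I := {k : 'I_n & I k})) => J [s [w [dE s0]]] k.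
pose tg k (i : I k) : {k : 'I_n & I k} := existT _ k i.
have c0 j k' : \sum_i s (tg k' i) j *: c k' i = 0.
  apply: (pure2_independent inde (y := fun k => \sum_i s (tg k i) j *: c k i)).
  under eq_bigr do rewrite pure_sumr.
  rewrite sig_big_dep -[RHS](s0 j) /=; apply: eq_bigr => -[k1 i] _ /=.
  by rewrite pureZr.
transitivity (\sum_j pure2 (\sum_i s (tg k i) j *: c k i) (w j)).
  under [RHS]eq_bigr do rewrite pure_suml.
  rewrite exchange_big; apply: eq_bigr => i _.
  rewrite -[d k i]/(d (tag (tg k i)) (tagged (tg k i))) dE pure_sumr.
  by apply: eq_bigr => j _; rewrite pureZl pureZr.
by rewrite big1 // => j _; rewrite c0 pure0l.
Qed.

(** Independence allows the [e k] to be cancelled from the right counit law, giving the identity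
    matrix, and from coassociativity, giving multiplicativity. *)
Lemma comodule_is_rep n (e : 'I_n -> A) (M : 'M[A]_n) : independent e ->
  (forall j, comul (e j) = \sum_k pure2 (e k) (M k j)) -> is_rep G M.
Proof.
move=> inde eE; split=> [B g h|B]; last first.
  apply/matrixP => i j; rewrite !mxE goneE.
  suff -> : counit G (M i j) = (i == j)%:R by case: eqP; rewrite ?scale1r ?scale0r.
  apply/eqP; rewrite -subr_eq0; apply/eqP.
  apply: (inde (fun i => counit G (M i j) - (i == j)%:R)).
  under eq_bigr do rewrite scalerBl.
  rewrite sumrB -(counitr (eE j)) (bigD1 j) //= eqxx scale1r big1 ?addr0 ?subrr //.
  by move=> k /negPf ->; rewrite scale0r.
suff comulM k j : comul (M k j) = \sum_l pure2 (M k l) (M l j).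
  by apply/matrixP => i j; rewrite !mxE (gmul_sum _ _ (comulM i j)); apply: eq_bigr => l _; rewrite !mxE.
have [Q [c [d ME]]] := tensor_sum_family (fun k => comul (M k j)).
have := coassociativity (eE j) ME.
pose c' (k : 'I_n) (q : Q k + 'I_n) := match q with inl q => c k q | inr l => - M k l end.
pose d' (k : 'I_n) (q : Q k + 'I_n) := match q with inl q => d k q | inr l => M l j end.
move=> coassE.
have /(pure3_independent inde)/(_ k) : \sum_k \sum_i pure3 (pure2 (e k) (c' k i)) (d' k i) = 0.
  under eq_bigr do rewrite big_sumType /=.
  rewrite big_split /= -coassE exchange_big -big_split big1 //= => l _.
  rewrite eE pure_suml -big_split big1 //= => m _.
  by rewrite pureNr pureNl subrr.
rewrite big_sumType /= -ME => /eqP; rewrite addr_eq0 => /eqP ->.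
rewrite -sumrN; apply: eq_bigr => l _.
by rewrite pureNl opprK.
Qed.

(** [V] is cut out by the left factors [a] of [comul x]; it is finite free, and Serre's argument
    makes it a subcomodule. The left counit law on its basis [e] shows that [c] must be the vector
    of counits of the [e k]. *)
Lemma matrix_coefficient (x : A) :
  exists (n : nat) (M : 'M[A]_n) (c v : 'I_n -> R),
    is_rep G M /\ x = \sum_i c i *: coact M v i.
Proof.
have [I [a [b xE]]] := tensor_sum (comul x).
pose V := lcomodule G Aflat a.
have Vx : V x by exists b.
have [|n [e [Ve espan inde]]] := @free_basis R pi Hdvr A V (flat_torsion_free Aflat).
  pose a' (i : nat) := oapp (fun k : 'I_#|I| => a (enum_val k)) 0 (insub i).
  apply: (noetherian Hdvr (a := a') (n := #|I|)).
    exact: lcomodule_submodule.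
  (* The right counit law places [V] inside the span of the finite family [a]. *)
  move=> y [b' /counitr yE].
  exists (fun i : nat => oapp (fun k : 'I_#|I| => counit G (b' (enum_val k))) 0 (insub i)).
  rewrite yE (big_enum_val (A := I)); apply: eq_bigr => i _.
  by rewrite /a' valK.
have /choice[M eE] : forall j, exists m : 'I_n -> A, comul (e j) = \sum_k pure2 (e k) (m k).
  move=> j; have [J [f [w [Vf ->]]]] := lcomodule_stable (Ve j).
  have /choice[t tE] : forall p, exists t : 'I_n -> R, f p = \sum_k t k *: e k.
    by move=> p; apply/espan/Vf.
  exists (fun k => \sum_p t p k *: w p).
  under [RHS]eq_bigr do rewrite pure_sumr.
  rewrite exchange_big; apply: eq_bigr => p _; rewrite tE pure_suml.
  by apply: eq_bigr => k _; rewrite pureZl pureZr.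
have [v ->] := espan x Vx.
exists n, (\matrix_(k, j) M j k), (fun k => counit G (e k)), v; split.
  by apply: (comodule_is_rep inde) => j; rewrite eE; apply: eq_bigr => k _; rewrite mxE.
under eq_bigr => j _ do rewrite (counitl (eE j)) scaler_sumr.
rewrite exchange_big; apply: eq_bigr => k _; rewrite /coact scaler_sumr.
by apply: eq_bigr => j _; rewrite !scalerA mulrC mxE.
Qed.

End MatrixCoefficients.

(** * Saturated submodules and Chevalley's theorem *)

Section CompleteDVR.
Variables (R : idomainType) (pi : R).
Hypothesis Hdvr : is_dvr_uniformizer pi.

Lemma uniformizer_not_unit y : pi * y != 1.
Proof.
have [_ piNU _] := Hdvr; apply: contraNneq piNU => piy.
by apply/unitrP; exists y; rewrite mulrC piy.
Qed.

Lemma dvr_unit x : ~ (exists y, x = pi * y) -> x \is a GRing.unit.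
Proof.
move=> Ndvd; have [_ _ valR] := Hdvr; have [x0|/valR[[|k] [u [Uu xE]]]] := eqVneq x 0.
- by case: Ndvd; exists 0; rewrite mulr0.
- by rewrite xE expr0 mulr1.
- by case: Ndvd; exists (pi ^+ k * u); rewrite mulrA -exprS mulrC.
Qed.

Lemma dvr_separated (x : R) : (forall n, exists y, x = pi ^+ n * y) -> x = 0.
Proof.
have [pi0 _ valR] := Hdvr; move=> divx; apply/eqP/contraT => /valR[k [u [Uu xE]]].
have [y] := divx k.+1; rewrite xE exprSr -mulrA mulrC => /(mulfI (expf_neq0 k pi0)) uE.
by have := uniformizer_not_unit (y * u^-1); rewrite mulrA -uE divrr ?eqxx.
Qed.

(** A frame of maximal size is taken. Subtracting from [v] in [W] its part along [B] leaves a vector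
    vanishing on the rows [S]; were it nonzero, its primitive part, in [W] by saturation, would
    enlarge the frame. The identity block makes coordinates in [W] a mere choice of rows. *)
Lemma saturated_frame (n : nat) (W : 'cV[R]_n -> Prop) :
  W 0 -> submodule W -> (forall r v, r != 0 -> W (r *: v) -> W v) ->
  exists (r : nat) (S : 'I_r -> 'I_n) (B : 'M[R]_(n, r)),
    [/\ rowsub S B = 1%:M, forall p, W (col p B) &
        forall v, W v -> v = B *m rowsub S v].
Proof.
move=> W0 subW satW.
pose Q r := `[< exists (S : 'I_r -> 'I_n) (B : 'M[R]_(n, r)),
  rowsub S B = 1%:M /\ forall p, W (col p B) >].
have exQ : exists r, Q r.
  exists 0%N; apply/asboolP; have S : 'I_0 -> 'I_n by case.
  by exists S, 0; split=> [|[]//]; apply/matrixP; case.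
have Qle r : Q r -> (r <= n)%N.
  case/asboolP => S [B [SB1 _]]; rewrite -(card_ord r) -[X in (_ <= X)%N](card_ord n).
  apply: (leq_card S) => i j Sij; apply/eqP/contraT => ij.
  have := congr1 (fun M : 'M_r => M i i) SB1; have := congr1 (fun M : 'M_r => M j i) SB1.
  rewrite !mxE Sij eqxx => ->; rewrite eq_sym (negPf ij) => /eqP.
  by rewrite eq_sym oner_eq0.
case: (ex_maxnP exQ Qle) => r /asboolP[S [B [SB1 WB]]] maxr.
have WBu u : W (B *m u).
  have -> : B *m u = \sum_p u p 0 *: col p B.
    apply/colP => i; rewrite mxE summxE; apply: eq_bigr => p _.
    by rewrite !mxE mulrC.
  by elim/big_rec: _ => // p v _ Wv; apply: subW.
exists r, S, B; split=> // v Wv; apply/eqP; rewrite -subr_eq0; apply: contraT => /cV0Pn[i].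
set v' := v - _ => v'i; suff : Q r.+1 by move/maxr; rewrite ltnn.
have Wv' : W v' by rewrite /v' addrC -scaleN1r; apply: subW.
have v'S p : v' (S p) 0 = 0.
  have -> : v' (S p) 0 = (rowsub S v') p 0 by rewrite [RHS]mxE.
  by rewrite /v' linearB /= -mul_rowsub_mx SB1 mul1mx subrr mxE.
clearbody v'; have [i0 [t [v'0 t0 tE0]]] := primitive_part Hdvr (v := fun i => v' i 0) v'i.
have tE j : v' j 0 = v' i0 0 * t j := tE0 j.
pose u : 'cV[R]_n := \col_j t j.
have Wu : W u.
  apply: (satW (v' i0 0)) => //; suff -> : v' i0 0 *: u = v' by [].
  by apply/colP => j; rewrite !mxE -tE.
have tS p : t (S p) = 0 by apply: (mulfI v'0); rewrite -tE v'S mulr0.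
rewrite /Q -addn1; apply/asboolP.
exists (fun p : 'I_(r + 1) => match split p with inl q => S q | inr _ => i0 end).
(* The correction clears row [i0] of the old columns; it leaves the rows [S] unchanged since [u]
   vanishes there. *)
exists (row_mx (B - u *m row i0 B) u); split.
  apply/matrixP => p q; rewrite !mxE.
  have SBE p' q' : B (S p') q' = (p' == q')%:R.
    by have := congr1 (fun M : 'M_r => M p' q') SB1; rewrite !mxE.
  case: splitP => q' qE; case: splitP => p' pE; rewrite !(mxE, big_ord1) ?tS ?t0.
  - by rewrite mul0r subr0 SBE; congr (_ %:R); rewrite -!val_eqE /= pE qE.
  - rewrite mul1r subrr -val_eqE /= pE qE.
    by have /gtn_eqF -> : (q' < r + p')%N by apply: ltn_addr.
  - rewrite -val_eqE /= pE qE.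
    by have /ltn_eqF -> : (p' < r + q')%N by apply: ltn_addr.
  - by rewrite -val_eqE /= pE qE !ord1 eqxx.
move=> p; rewrite -[p]splitK; case: (split p) => q /=.
  rewrite colKl linearB /=.
  have -> : col q (u *m row i0 B) = B i0 q *: u.
    by apply/colP => j; rewrite !mxE big_ord1 !mxE mulrC.
  by rewrite addrC -scaleNr; apply: subW.
rewrite colKr; suff -> : col q u = u by [].
by apply/colP => j; rewrite !mxE.
Qed.

Section Chevalley.
Hypothesis Hcompl : pi_adically_complete pi.
Variables (M : lmodType R) (tfM : torsion_free M).

Definition pdvd (V : lmodType R) (k : nat) (x : V) : Prop := exists y, x = pi ^+ k *: y.

Lemma pdvdP (V : lmodType R) (k : nat) a (x y : V) :
  pdvd k x -> pdvd k y -> pdvd k (a *: x + y).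
Proof.
move=> [x' ->] [y' ->]; exists (a *: x' + y').
by rewrite scalerDr !scalerA mulrC.
Qed.

Lemma pdvd_le (V : lmodType R) (k m : nat) (x : V) : (k <= m)%N -> pdvd m x -> pdvd k x.
Proof.
move=> km [y ->]; exists (pi ^+ (m - k) *: y).
by rewrite scalerA -exprD subnKC.
Qed.

Lemma pdvd0 (V : lmodType R) k : pdvd k (0 : V).
Proof. by exists 0; rewrite scaler0. Qed.

Variables (n : nat) (e : 'I_n -> M).

Definition lin_eval (v : 'cV[R]_n) : M := \sum_i v i 0 *: e i.

Lemma lin_evalP a v w : lin_eval (a *: v + w) = a *: lin_eval v + lin_eval w.
Proof.
rewrite /lin_eval scaler_sumr -big_split; apply: eq_bigr => i _.
by rewrite !mxE scalerDl scalerA.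
Qed.

Lemma lin_evalZ a v : lin_eval (a *: v) = a *: lin_eval v.
Proof.
by rewrite /lin_eval scaler_sumr; apply: eq_bigr => i _; rewrite mxE scalerA.
Qed.

Definition supported (D : {set 'I_n}) (v : 'cV[R]_n) : Prop :=
  forall i, i \notin D -> v i 0 = 0.

Lemma supportedP D a v w : supported D v -> supported D w -> supported D (a *: v + w).
Proof. by move=> sv sw i iD; rewrite !mxE sv // sw // mulr0 addr0. Qed.

(* Chevalley's theorem: a decreasing sequence of submodules of R^D with zero
   intersection is eventually contained in every pi^m R^D.  If not, some
   coordinate i is infinitely often a unit; normalising it to 1 and applying
   the induction hypothesis to D \ {i} makes the chosen vectors a Cauchy
   sequence, whose limit is a nonzero element of the intersection. *)
Lemma chevalley (D : {set 'I_n}) :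
  (forall v, supported D v -> divisible_part pi (lin_eval v) -> v = 0) ->
  forall m, exists N, forall v, supported D v -> pdvd N (lin_eval v) -> pdvd m v.
Proof.
have [pi0 piNU _] := Hdvr.
have [d] := ubnP #|D|; elim: d D => // d IH D ltDd capD.
(* One factor [pi] suffices: it can be divided out of [v], which costs one factor in [lin_eval v],
   so [N + m] handles [pi ^+ m]. *)
suff [N Nprim] : exists N, forall v, supported D v -> pdvd N (lin_eval v) -> pdvd 1 v.
  move=> m; exists (N + m)%N; elim: m => [|m IHm] v sv dv.
    by exists v; rewrite scale1r.
  have [|v' vE] := Nprim v sv; first by apply: pdvd_le dv; apply: leq_addr.
  rewrite expr1 in vE; have [||u v'E] := IHm v'.
  - move=> i iD; have /eqP := sv i iD.
    by rewrite vE mxE mulf_eq0 (negPf pi0) => /eqP.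
  - have [y dE] := dv; exists y; apply: (torsion_free_inj tfM pi0).
    by rewrite -lin_evalZ -vE dE addnS exprS scalerA.
  by exists u; rewrite vE v'E scalerA exprS.
apply: contrapT => /forallNP noN.
have unitv N : exists i, i \in D /\
    exists v, [/\ supported D v, pdvd N (lin_eval v) & v i 0 = 1].
  have /existsNP[v /not_implyP[sv /not_implyP[dv Npv]]] := noN N.
  have [i Uvi] : exists i, v i 0 \is a GRing.unit.
    apply: contrapT => /forallNP NU; apply: Npv.
    have /choice[y yE] : forall i, exists y, v i 0 = pi * y.
      by move=> i; apply: contrapT => /dvr_unit /NU.
    by exists (\col_i y i); apply/colP => i; rewrite !mxE expr1.
  exists i; split.
    by apply: contraLR Uvi => /sv ->; rewrite unitr0.
  exists ((v i 0)^-1 *: v); split; last by rewrite mxE mulVr.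
    by move=> j /sv vj; rewrite mxE vj mulr0.
  have [y yE] := dv; exists ((v i 0)^-1 *: y).
  by rewrite lin_evalZ yE !scalerA mulrC.
(* Pigeonhole: if every coordinate [i] failed from some [K i] on, the maximum of the [K i] would
   contradict [unitv]. *)
have [i [iD /choice[v vP]]] : exists i, i \in D /\ forall N,
    exists v, [/\ supported D v, pdvd N (lin_eval v) & v i 0 = 1].
  apply: contrapT => /forallNP noi.
  have /choice[K KP] : forall i, exists K, i \in D ->
      ~ exists v, [/\ supported D v, pdvd K (lin_eval v) & v i 0 = 1].
    move=> i; case: (boolP (i \in D)) => iD; last by exists 0%N.
    apply: contrapT => /forallNP noK; apply: (noi i); split=> // K.
    by have /not_implyP[_ /contrapT] := noK K.
  have [i [iD [v [sv dv vi]]]] := unitv (\max_i K i).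
  apply: (KP i iD); exists v; split=> //; apply: pdvd_le dv.
  exact: (leq_bigmax i).
have /choice[L LP] : forall m, exists N, forall v, supported (D :\ i) v ->
    pdvd N (lin_eval v) -> pdvd m v.
  apply: IH; first by move: ltDd; rewrite (cardsD1 i) iD.
  by move=> w sw; apply: capD => j jD; apply: sw; rewrite in_setD1 (negPf jD) andbF.
(* Summing makes [K] monotone. The term [L m] makes successive differences, which vanish at [i],
   divisible by [pi ^+ m]; the term [m] makes the image of the limit divisible. *)
pose K m := \sum_(l < m.+1) (L l + l)%N.
have KS m : (K m <= K m.+1)%N by rewrite /K [X in (_ <= X)%N]big_ord_recr leq_addr.
have LK m : (L m + m <= K m)%N by rewrite /K big_ord_recr leq_addl.
have cauchy m : pdvd m (v (K m.+1) - v (K m)).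
  have [s1 d1 v1] := vP (K m); have [s2 d2 v2] := vP (K m.+1).
  rewrite addrC -scaleN1r; apply: LP.
    move=> j; rewrite in_setD1 negb_and negbK => /predU1P[->|jD].
      by rewrite !mxE v1 v2 mulN1r addNr.
    by apply: supportedP jD.
  rewrite lin_evalP; apply: pdvdP.
    by apply: pdvd_le d1; apply: leq_trans (LK m); apply: leq_addr.
  apply: pdvd_le d2; apply: leq_trans (KS m); apply: leq_trans (LK m).
  exact: leq_addr.
have /choice[l lP] : forall j, exists l, forall m, exists y, l - v (K m) j 0 = pi ^+ m * y.
  move=> j; apply: (Hcompl (x := fun m => v (K m) j 0)) => m.
  by have [y /colP/(_ j)] := cauchy m; rewrite !mxE => ->; exists (y j 0).
pose w : 'cV[R]_n := \col_j l j.
have limw m : pdvd m (w - v (K m)).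
  have /choice[y yE] : forall j, exists y, l j - v (K m) j 0 = pi ^+ m * y.
    by move=> j; apply: lP.
  by exists (\col_j y j); apply/colP => j; rewrite !mxE yE.
have w0 : w = 0.
  apply: capD => [j jD|m].
    rewrite mxE; apply: dvr_separated => m; have [y] := lP j m.
    by have [sv _ _] := vP (K m); rewrite sv // subr0 => ->; exists y.
  have [u uE] := limw m; have [_ dv _] := vP (K m).
  have -> : w = pi ^+ m *: u + v (K m) by rewrite -uE subrK.
  rewrite lin_evalP; rewrite -[_ *: lin_eval u]scale1r; apply: pdvdP; first by exists (lin_eval u).
  by apply: pdvd_le dv; apply: leq_trans (LK m); apply: leq_addl.
have [u /colP/(_ i)] := limw 1%N; have [_ _ vi] := vP (K 1%N).
rewrite w0 !mxE vi sub0r expr1 => /eqP; rewrite eqr_oppLR -mulrN eq_sym.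
by rewrite (negPf (uniformizer_not_unit _)).
Qed.

End Chevalley.
End CompleteDVR.

(** * Minors *)

Section Minors.
Variable S : comNzRingType.

(** Cauchy-Binet before grouping: the sum runs over all maps [g], which index the basis of the
    [r]-th tensor power. *)
Lemma det_mul_rect (r n : nat) (X : 'M[S]_(r, n)) (Y : 'M[S]_(n, r)) :
  \det (X *m Y) = \sum_(g : {ffun 'I_r -> 'I_n}) (\prod_p X p (g p)) * \det (rowsub g Y).
Proof.
rewrite /determinant; under [RHS]eq_bigr do rewrite mulr_sumr.
rewrite exchange_big; apply: eq_bigr => s _ /=.
under eq_bigr do rewrite mxE.
rewrite bigA_distr_bigA mulr_sumr; apply: eq_bigr => g _ /=.
rewrite mulrCA -big_split; congr (_ * _); apply: eq_bigr => p _.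
by rewrite mxE.
Qed.

(** Cramer's rule, used to recover a matrix from those minors that differ from a fixed one in a
    single row. *)
Lemma det_replace_row (r n : nat) (f : 'I_r -> 'I_n) (Y : 'M[S]_(n, r)) k p :
  \det (rowsub [ffun q => if q == p then k else f q] Y) = (Y *m \adj (rowsub f Y)) k p.
Proof.
rewrite (expand_det_row _ p) mxE; apply: eq_bigr => q _.
rewrite !mxE ffunE eqxx; congr (_ * (_ * \det _)).
apply/matrixP => i j; rewrite !mxE ffunE.
by rewrite eq_sym (negPf (neq_lift _ _)).
Qed.

End Minors.

Section Congruence.
Variables (R : comNzRingType) (A : comAlgType R) (pi : R) (m : nat).

Lemma det_congr (r : nat) (X Y : 'M[A]_r) :
  (forall i j, exists b, X i j - Y i j = pi ^+ m *: b) ->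
  exists b, \det X - \det Y = pi ^+ m *: b.
Proof.
move=> XY; rewrite /determinant -sumrB.
have prodP s : exists b, \prod_i X i (s i) - \prod_i Y i (s i) = pi ^+ m *: b.
  elim/big_ind2: _ => [|y x t z [b xy] [c zt]|i _].
  - by exists 0; rewrite subrr scaler0.
  - exists (b * z + y * c); rewrite scalerDr scalerAl scalerAr -xy -zt.
    by rewrite mulrBl mulrBr addrA subrK.
  - exact: XY.
elim/big_ind: _ => [|x y [b ->] [c ->]|s _].
- by exists 0; rewrite scaler0.
- by exists (b + c); rewrite scalerDr.
have [b bE] := prodP (fun i => s i); exists ((-1) ^+ s * b).
by rewrite -mulrBr bE scalerAr.
Qed.

End Congruence.

Section PrudentFinite.
Variables (R : comNzRingType) (pi : R) (A : comAlgType R) (G : affine_group_scheme A).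

(** Lets prudence be applied to the tensor power with its basis indexed by maps, without numbering
    them. *)
Lemma prudent_finType (F : finType) (P : F -> F -> A) (v : F -> R) :
  prudent pi G ->
  (forall (B : comAlgType R) (g h : pts A B) a b,
     gmul G g h (P a b) = \sum_c g (P a c) * h (P c b)) ->
  (forall (B : comAlgType R) a b, gone G B (P a b) = (a == b)%:R) ->
  (forall k, exists theta, forall a, exists b,
     \sum_c v c *: P a c - v a *: theta = pi ^+ k *: b) ->
  exists theta, forall a, \sum_c v c *: P a c = v a *: theta.
Proof.
move=> Gprud PM P1 vmod.
have reindexF (V : nmodType) (f : F -> V) : \sum_c f c = \sum_(i < #|F|) f (enum_val i).
  exact: (big_enum_val (A := F)).
pose M : 'M[A]_#|F| := \matrix_(i, j) P (enum_val i) (enum_val j).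
pose w (i : 'I_#|F|) := v (enum_val i).
have coactE i : coact M w i = \sum_c v c *: P (enum_val i) c.
  by rewrite reindexF; apply: eq_bigr => j _; rewrite mxE.
have [||theta wE] := Gprud _ M _ w.
- split=> [B g h|B]; apply/matrixP => i j; rewrite !mxE.
    by rewrite PM reindexF; apply: eq_bigr => k _; rewrite !mxE.
  by rewrite P1 (inj_eq enum_val_inj).
- move=> k; have [theta thetaP] := vmod k.+1; exists theta => i.
  by have [b bE] := thetaP (enum_val i); exists b; rewrite coactE.
exists theta => a; have := wE (enum_rank a).
by rewrite coactE /w enum_rankK.
Qed.

End PrudentFinite.

(** * Stability of the divisible kernel *)

Section Stability.
Variables (R : idomainType) (pi : R).
Hypotheses (Hdvr : is_dvr_uniformizer pi) (Hcompl : pi_adically_complete pi).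
Variables (A : comAlgType R) (G : affine_group_scheme A).
Hypothesis Aflat : flat_module A.
Variables (n : nat) (M : 'M[A]_n) (c : 'I_n -> R).
Hypothesis Mrep : is_rep G M.

Local Notation pure2 := (pure Aflat (@coord_scalars_inject R A G)).
Local Notation comul := (comul G Aflat).
Local Notation inA := (map_mx (in_alg A)).

Lemma rep_mul_entry (C : comAlgType R) (g h : pts A C) i j :
  gmul G g h (M i j) = \sum_k g (M i k) * h (M k j).
Proof.
have /matrixP/(_ i j) := Mrep.1 C g h; rewrite !mxE => ->.
by apply: eq_bigr => k _; rewrite !mxE.
Qed.

Lemma rep_one_entry (C : comAlgType R) i j : gone G C (M i j) = (i == j)%:R.
Proof. by have /matrixP/(_ i j) := Mrep.2 C; rewrite !mxE. Qed.

Definition coef_row (j : 'I_n) : A := \sum_i c i *: M i j.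

(** The submodule [W] of the overview. *)
Definition div_kernel (v : 'cV[R]_n) : Prop := divisible_part pi (lin_eval coef_row v).

Lemma mul_inA (r : nat) (B : 'M[R]_(n, r)) k p :
  (M *m inA B) k p = \sum_j B j p *: M k j.
Proof. by rewrite mxE; apply: eq_bigr => j _; rewrite mxE mulr_algr. Qed.

Lemma div_kernel_submodule : submodule div_kernel.
Proof.
move=> a v w Wv Ww m; rewrite lin_evalP.
by apply: pdvdP; [apply: Wv | apply: Ww].
Qed.

Lemma div_kernel0 : div_kernel 0.
Proof. by move=> m; exists 0; rewrite scaler0 -[in LHS](scale0r 0) lin_evalZ scale0r. Qed.

Lemma div_kernel_saturated r v : r != 0 -> div_kernel (r *: v) -> div_kernel v.
Proof.
have [pi0 _ valR] := Hdvr; move=> /valR[k [u [Uu ->]]] Wv m.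
(* The extra [k] factors are used up when [pi ^+ k] is cancelled. *)
have [y] := Wv (m + k)%N; rewrite lin_evalZ => yE; exists (u^-1 *: y).
apply: (torsion_free_inj (flat_torsion_free Aflat) (expf_neq0 k pi0)).
have -> : pi ^+ k *: lin_eval coef_row v = u^-1 *: ((u * pi ^+ k) *: lin_eval coef_row v).
  by rewrite scalerA mulrA mulVr // mul1r.
by rewrite yE !scalerA ?mulrA [in LHS]mulrC addnC exprD.
Qed.

Lemma counit_coef_row j : counit G (coef_row j) = c j.
Proof.
rewrite /counit /coef_row raddf_sum (bigD1 j) //= big1 ?addr0 => [|i ij].
  by rewrite linearZ /= rep_one_entry eqxx; apply: mulr1.
by rewrite linearZ /= rep_one_entry (negPf ij); apply: mulr0.
Qed.

(** The counit sends [c M v] to [c v] and preserves divisibility, and [R] is separated. *)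
Lemma counit_div_kernel v : div_kernel v -> \sum_i v i 0 * c i = 0.
Proof.
move=> Wv; apply: (dvr_separated Hdvr) => m; have [y yE] := Wv m.
exists (counit G y); rewrite -counitZ -yE /lin_eval /counit raddf_sum.
by apply: eq_bigr => i _; rewrite -[RHS]/(counit G _) counitZ counit_coef_row.
Qed.

Lemma comul_matrix i j : comul (M i j) = \sum_k pure2 (M i k) (M k j).
Proof.
rewrite [LHS]rep_mul_entry; apply: eq_bigr => k _.
by rewrite /= /tinl /tinr -pure_split.
Qed.

Lemma comul_lin_eval (w : 'cV[R]_n) :
  comul (lin_eval coef_row w) = \sum_k pure2 (coef_row k) ((M *m inA w) k 0).
Proof.
rewrite /lin_eval comul_sum; under [RHS]eq_bigr do rewrite mul_inA pure_sumr.
rewrite exchange_big; apply: eq_bigr => j _; rewrite comulZ /coef_row comul_sum scaler_sumr.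
under [RHS]eq_bigr do rewrite pure_suml.
rewrite exchange_big; apply: eq_bigr => i _; rewrite comulZ comul_matrix !scaler_sumr.
by apply: eq_bigr => k _; rewrite pureZl pureZr !scalerA mulrC.
Qed.

Variables (r : nat) (S : 'I_r -> 'I_n) (B : 'M[R]_(n, r)).
Hypotheses (SB1 : rowsub S B = 1%:M) (WB : forall p, div_kernel (col p B))
  (Wspan : forall v, div_kernel v -> v = B *m rowsub S v).

Let SBE p q : B (S p) q = (p == q)%:R.
Proof. by have /matrixP/(_ p q) := SB1; rewrite !mxE. Qed.

(** The coordinates outside [S] span a complement of [W]; on it Chevalley's theorem applies. *)
Let frame_separated v : supported (~: [set S p | p : 'I_r]) v -> div_kernel v -> v = 0.
Proof.
move=> sv /Wspan ->; suff -> : rowsub S v = 0 by rewrite mulmx0.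
apply/colP => p; rewrite !mxE sv // inE negbK; exact: imset_f.
Qed.

Lemma lin_eval_frame (u : 'cV[R]_r) :
  lin_eval coef_row (B *m u) = \sum_p u p 0 *: lin_eval coef_row (col p B).
Proof.
rewrite /lin_eval; under [RHS]eq_bigr do rewrite scaler_sumr.
rewrite exchange_big; apply: eq_bigr => i _; rewrite mxE scaler_suml.
by apply: eq_bigr => p _; rewrite mxE scalerA mulrC.
Qed.

(** [z] is the component of [M w] in the complement of [W]. As [w] and the columns of [B] lie in
    [W], the tensor pairing the row [c M] with [z] is divisible by [pi ^+ N]. The criterion writes
    [z] as a combination of vectors [v j] over [R] with [c M v] divisible by [pi ^+ N], and
    Chevalley's theorem applies to their projections. *)
Lemma frame_congruence w m k : div_kernel w ->
  exists b, (M *m inA w) k 0 - \sum_p B k p *: (M *m inA w) (S p) 0 = pi ^+ m *: b.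
Proof.
move=> Ww; set y := M *m inA w.
have [N NP] := chevalley Hdvr Hcompl (flat_torsion_free Aflat) frame_separated m.
pose z k := y k 0 - \sum_p B k p *: y (S p) 0.
have zS p : z (S p) = 0.
  rewrite /z (bigD1 p) //= SBE eqxx scale1r big1 ?addr0 ?subrr // => q.
  by rewrite eq_sym SBE => /negPf ->; rewrite scale0r.
have [t tE] : exists t, \sum_k pure2 (coef_row k) (z k) = pi ^+ N *: t.
  have [a aE] := Ww N; have /choice[d dE] : forall p, exists d,
    lin_eval coef_row (col p B) = pi ^+ N *: d by move=> p; apply: WB.
  exists (comul a - \sum_p pure2 (d p) (y (S p) 0)).
  rewrite scalerBr -comulZ -aE comul_lin_eval scaler_sumr.
  under eq_bigr do rewrite /z pureDr pureNr.
  rewrite big_split /= sumrN; congr (_ - _).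
  under [RHS]eq_bigr do rewrite -pureZl -dE /lin_eval pure_suml.
  rewrite exchange_big; apply: eq_bigr => j _; rewrite pure_sumr.
  by apply: eq_bigr => p _; rewrite [col _ _ _ _]mxE pureZl pureZr.
have [L [a [b tab]]] := tensor_sum t.
pose x2 (l : 'I_n + L) := match l with inl j => coef_row j | inr l => - pi ^+ N *: a l end.
pose z2 (l : 'I_n + L) := match l with inl j => z j | inr l => b l end.
have : \sum_l pure2 (x2 l) (z2 l) = 0.
  rewrite big_sumType /= tE tab scaler_sumr -big_split big1 //= => l _.
  by rewrite scaleNr pureNl pureZl subrr.
move=> /pure_sum_eq0[J [s [f [zE s0]]]].
pose v j : 'cV[R]_n := \col_i s (inl i) j.
have vE j i : v j i 0 = s (inl i) j by rewrite /v mxE.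
(* The subtracted part lies in [W], so its image is divisible by every power of [pi] and that of
   [v' j] remains divisible by [pi ^+ N]. *)
pose v' j := v j - B *m rowsub S (v j).
have /choice[u uE] : forall j, pdvd pi m (v' j).
  move=> j; apply: NP.
    move=> i; rewrite inE negbK => /imsetP[p _ ->].
    rewrite /v' !mxE; under eq_bigr do rewrite SBE !mxE.
    rewrite (bigD1 p) //= eqxx mul1r big1 ?addr0 ?subrr // => q.
    by rewrite eq_sym => /negPf ->; rewrite mul0r.
  rewrite /v' addrC -scaleN1r lin_evalP; apply: pdvdP.
    rewrite lin_eval_frame; elim/big_rec: _ => [|p x _ dx]; first exact: pdvd0.
    by apply: pdvdP => //; apply: WB.
  exists (\sum_l s (inr l) j *: a l).
  have /eqP := s0 j; rewrite big_sumType /= addr_eq0 -sumrN => /eqP e1.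
  transitivity (\sum_i s (inl i) j *: coef_row i).
    by apply: eq_bigr => i _; rewrite vE.
  rewrite e1 scaler_sumr; apply: eq_bigr => l _.
  by rewrite scaleNr scalerN opprK !scalerA mulrC.
exists (\sum_j u j k 0 *: f j).
have zv i : z i = \sum_j v j i 0 *: f j.
  by rewrite -[z i]/(z2 (inl i)) zE; apply: eq_bigr => j _; rewrite vE.
(* Projecting [z] changes nothing, as it vanishes on the rows [S]; it merely replaces each [v j] by
   [v' j]. *)
transitivity (z k - \sum_p B k p *: z (S p)).
  by rewrite -[LHS]/(z k) [X in _ = _ - X]big1 ?subr0 // => p _; rewrite zS scaler0.
rewrite scaler_sumr zv; under [X in _ - X]eq_bigr do rewrite zv scaler_sumr.
rewrite exchange_big -sumrB; apply: eq_bigr => j _.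
have -> : pi ^+ m *: (u j k 0 *: f j) = v' j k 0 *: f j by rewrite uE mxE scalerA.
rewrite /v' !mxE scalerBl; congr (_ - _); rewrite scaler_suml.
by apply: eq_bigr => p _; rewrite !mxE scalerA.
Qed.

Hypothesis Gprud : prudent pi G.

Let Theta := rowsub S (M *m inA B).

(** [P] is the matrix of the [r]-th tensor power, and by [det_mul_rect] it takes the vector of
    minors of [B] to the minors of [M B]. *)
Lemma frame_minors : exists theta, forall f : {ffun 'I_r -> 'I_n},
  \det (rowsub f (M *m inA B)) = \det (rowsub f B) *: theta.
Proof.
pose P (f g : {ffun 'I_r -> 'I_n}) : A := \prod_p M (f p) (g p).
have minorE f : \sum_(g : {ffun 'I_r -> 'I_n}) \det (rowsub g B) *: P f g = \det (rowsub f (M *m inA B)).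
  rewrite -mul_rowsub_mx det_mul_rect; apply: eq_bigr => g _.
  rewrite -map_mxsub det_map_mx mulr_algr; congr (_ *: _).
  by apply: eq_bigr => p _; rewrite mxE.
have [||k|theta thetaE] := prudent_finType (P := P) (v := fun g : {ffun 'I_r -> 'I_n} => \det (rowsub g B)) Gprud.
- move=> C g h a b; rewrite /P rmorph_prod.
  transitivity (\prod_p \sum_k g (M (a p) k) * h (M k (b p))).
    by apply: eq_bigr => p _; apply: rep_mul_entry.
  rewrite bigA_distr_bigA; apply: eq_bigr => d _ /=.
  by rewrite big_split !rmorph_prod.
- move=> C a b; rewrite /P rmorph_prod.
  transitivity (\prod_p ((a p == b p)%:R : C)).
    by apply: eq_bigr => p _; apply: rep_one_entry.
  have [->|/eqP/ffunP ab] := eqVneq a b; first by rewrite big1 // => p _; rewrite eqxx.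
  have [p] : exists p, a p != b p.
    by apply: contrapT => /forallNP ab'; apply: ab => p; apply/eqP/negPn/negP/ab'.
  by move=> /negPf abp; rewrite (bigD1 p) //= abp mul0r.
(* The same eigenvalue serves for every [k], because [frame_congruence] compares [M B] with
   [B Theta] for one fixed [Theta]. *)
- exists (\det Theta) => f; rewrite minorE.
  have -> : \det (rowsub f B) *: \det Theta = \det (rowsub f (inA B *m Theta)).
    by rewrite -mul_rowsub_mx det_mulmx -map_mxsub det_map_mx mulr_algl.
  apply: det_congr => i p; have [b bE] := frame_congruence k (f i) (WB p); exists b.
  have colE j : (M *m inA (col p B)) j 0 = (M *m inA B) j p.
    by rewrite !mul_inA; apply: eq_bigr => l _; rewrite mxE.
  rewrite -bE colE [rowsub _ _ i p]mxE; congr (_ - _).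
  rewrite [LHS]mxE [LHS]mxE; apply: eq_bigr => q _.
  by rewrite [inA B _ _]mxE mulr_algl colE /Theta [rowsub _ _ _ _]mxE.
by exists theta => f; rewrite -minorE.
Qed.

(** The minors alone yield [M B] times the adjugate of [Theta] equal to [theta B]; to remove the
    adjugate, [theta] must be invertible. *)
Lemma frame_stable : M *m inA B = inA B *m Theta.
Proof.
have [theta minorE] := frame_minors.
have detS : \det Theta = theta.
  have := minorE (finfun S); rewrite -[LHS]/(\det _).
  have rsE (T : comNzRingType) (Y : 'M[T]_(n, r)) : rowsub (finfun S) Y = rowsub S Y.
    by apply/matrixP => i j; rewrite !mxE ffunE.
  by rewrite !rsE SB1 det1 scale1r.
(* [theta] is the character by which [G] acts on the line of minors. Expanding the [S]-minor of
   [g(M) h(M) B] pulls out [h theta] and leaves [g theta]. *)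
have thetaM (C : comAlgType R) (g h : pts A C) : gmul G g h theta = g theta * h theta.
  have mapd (k : pts A C) : k theta = \det (rowsub S (map_mx k M *m map_mx (in_alg C) B)).
    rewrite -detS -det_map_mx map_mxsub map_mxM /=; congr (\det (rowsub S (_ *m _))).
    by apply/matrixP => i j; rewrite !mxE linearZ rmorph1.
  rewrite (mapd (gmul G g h)) (Mrep.1 C g h) -mulmxA -mul_rowsub_mx det_mul_rect.
  have minorh (f : {ffun 'I_r -> 'I_n}) : \det (rowsub f (map_mx h M *m map_mx (in_alg C) B)) = \det (rowsub f B) *: h theta.
    have := congr1 h (minorE f); rewrite linearZ /= => <-.
    rewrite -det_map_mx map_mxsub map_mxM /=; congr (\det (rowsub f (_ *m _))).
    by apply/matrixP => i j; rewrite !mxE linearZ rmorph1.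
  under eq_bigr do rewrite minorh -scalerAr scalerAl.
  rewrite -mulr_suml; congr (_ * _); rewrite (mapd g) -mul_rowsub_mx det_mul_rect.
  apply: eq_bigr => f _.
  have -> : \det (rowsub f (map_mx (in_alg C) B)) = (\det (rowsub f B))%:A.
    by rewrite -map_mxsub det_map_mx.
  by rewrite mulr_algr.
(* The inverse is the value of [theta] at the inverse of the universal point [idfun]. *)
have thetaV : exists t, theta * t = 1.
  have [h [hE _]] := gmulV G (idfun : pts A A); exists (h theta).
  rewrite -[theta in LHS]/((idfun : pts A A) theta) -thetaM hE.
  rewrite -detS -det_map_mx map_mxsub map_mxM /= Mrep.2 mul1mx.
  have -> : map_mx (gone G A) (inA B) = inA B.
    by apply/matrixP => i j; rewrite !mxE linearZ rmorph1.
  by rewrite -map_mxsub SB1 map_mx1 det1.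
have adjE : M *m inA B *m \adj Theta = theta *: inA B.
  apply/matrixP => k p; rewrite -det_replace_row minorE det_replace_row SB1 adj1 mulmx1.
  by rewrite !mxE mulr_algr.
have [t tE] := thetaV.
have : t *: (theta *: inA B *m Theta) = M *m inA B.
  rewrite -adjE -[_ *m \adj Theta *m _]mulmxA mul_adj_mx detS mul_mx_scalar scalerA [t * _]mulrC tE.
  exact: scale1r.
by rewrite -scalemxAl scalerA [t * _]mulrC tE scale1r => <-.
Qed.

Lemma coef_row_vanish v : div_kernel v -> lin_eval coef_row v = 0.
Proof.
move=> /Wspan vE; pose cA : 'rV[A]_n := \row_i (c i)%:A.
have cB0 : cA *m inA B = 0.
  apply/rowP => p; rewrite !mxE.
  under eq_bigr => i _ do rewrite !mxE mulr_algl scalerA.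
  rewrite -scaler_suml; suff -> : \sum_i c i * B i p = 0 by rewrite scale0r.
  apply: etrans (counit_div_kernel (WB p)).
  by apply: eq_bigr => i _; rewrite mxE mulrC.
have -> : lin_eval coef_row v = (cA *m (M *m inA v)) 0 0.
  rewrite mxE /lin_eval /coef_row; under eq_bigr do rewrite scaler_sumr.
  rewrite exchange_big; apply: eq_bigr => i _; rewrite mul_inA mxE mulr_algl scaler_sumr.
  by apply: eq_bigr => j _; rewrite !scalerA mulrC.
by rewrite vE map_mxM [M *m _]mulmxA frame_stable !mulmxA cB0 !mul0mx mxE.
Qed.

End Stability.

Theorem theorem6p11 (R : idomainType) (pi : R)
  (Hdvr : is_dvr_uniformizer pi) (Hcompl : pi_adically_complete pi)
  (A : comAlgType R) (G : affine_group_scheme A)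
  (Hflat : flat_module A) (Hprud : prudent pi G) :
  forall x : A, divisible_part pi x -> x = 0.
Proof.
move=> x; have [n [M [c [v [Mrep xE]]]]] := matrix_coefficient Hdvr G Hflat x.
have {}xE : x = lin_eval (coef_row M c) (\col_j v j).
  rewrite xE /lin_eval /coef_row /coact; under eq_bigr do rewrite scaler_sumr.
  rewrite exchange_big; apply: eq_bigr => j _; rewrite mxE scaler_sumr.
  by apply: eq_bigr => i _; rewrite !scalerA mulrC.
have [r [S [B [SB1 WB Wspan]]]] := saturated_frame Hdvr (div_kernel0 pi M c)
  (@div_kernel_submodule R pi A n M c) (@div_kernel_saturated R pi Hdvr A Hflat n M c).
(* Divisibility of [x = c M v] now says exactly that [v] lies in [W]. *)
rewrite xE => Wv.
exact: (coef_row_vanish Hdvr Hcompl Hflat Mrep SB1 WB Wspan Hprud Wv).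
Qed.
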